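(* Let $\Gamma$ be a word hyperbolic group and let $\mu$ be a non-elementary probability measure with finite first moment on $\Gamma$. There exists some $\rho_\ast$ with $0<\rho_\ast\le 1$ such that for all $0<\rho<\rho_\ast$, $$\|\pi^\rho_n-\mu_n\times\mu_n\|_{\mathrm{TV}}\to 1\quad\text{as } n\to\infty.$$
   Context: A probability measure $\mu$ on a word hyperbolic group $\Gamma$ is called non-elementary if its support generates, as a group, a non-elementary subgroup $\mathrm{gr}(\mu)$ of $\Gamma$ (equivalently, $\mathrm{gr}(\mu)$ contains a free group of rank greater than one). It has finite first moment if $\sum_{x\in\Gamma}|x|\mu(x)<\infty$ for some (equivalently, every) word norm $|\cdot|$ on $\Gamma$ associated with a finite generating set. For $\rho\in[0,1]$, the probability measure $\pi^\rho$ on $\Gamma\times\Gamma$ is $\pi^\rho:=\rho\,\mu\times\mu+(1-\rho)\mu_{\mathrm{diag}}$, where $\mu\times\mu$ is the product measure and $\mu_{\mathrm{diag}}((x,y))=\mu(x)$ if $x=y$ and $0$ otherwise. For a probability measure on a group, the subscript $n$ denotes the $n$-fold convolution power: $\mu_n$ is the law of $w_n=x_1\cdots x_n$, with $x_1,x_2,\dots$ independent with law $\mu$, and $\pi^\rho_n$ is the $n$-fold convolution of $\pi^\rho$ on the direct product group $\Gamma\times\Gamma$. For probability measures $\nu_1,\nu_2$ on a countable set $X$, $\|\nu_1-\nu_2\|_{\mathrm{TV}}:=\sup_{A\subset X}|\nu_1(A)-\nu_2(A)|$. *)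

(* Defs.v *)
From HB Require Import structures.
From mathcomp Require Import all_boot all_order all_algebra.
From mathcomp Require Import all_classical all_reals all_analysis.

Set Implicit Arguments.
Unset Strict Implicit.
Unset Printing Implicit Defensive.

Import Order.TTheory GRing.Theory Num.Theory.
Import numFieldNormedType.Exports.

Local Open Scope classical_set_scope.
Local Open Scope ring_scope.

Section Groups.
Variable G : groupType.
Implicit Types (S A H K : set G) (x y g : G) (n : nat).

Definition gen_subgroup A : set G :=
  smallest [set H | group_closed [in H]] A.

Definition finite_generating S : Prop :=
  finite_set S /\ gen_subgroup S = [set: G].

Definition finite_index K H : Prop :=
  K `<=` H /\
  exists F : set G, [/\ finite_set F, F `<=` H &
    H = \bigcup_(f in F) [set (f * k)%g | k in K]].

(* Virtually cyclic; this includes the finite subgroups, by taking g = 1. *)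
Definition elementary H : Prop :=
  exists g, finite_index (gen_subgroup [set g]) H.

Definition is_word S x n : Prop :=
  exists w : seq G, [/\ size w = n,
    forall s, s \in w -> S s \/ S s^-1%g &
    (\prod_(s <- w) s)%g = x].

(* The default value 0 is never taken when S generates G. *)
Definition word_norm S x : nat :=
  if pselect (exists n, `[< is_word S x n >]) is left ex then ex_minn ex else 0.

End Groups.

Section Hyperbolicity.
Variable R : realType.

Definition word_dist (G : groupType) (S : set G) (x y : G) : R :=
  (word_norm S (x^-1 * y)%g)%:R.

Definition gromov_product (X : Type) (d : X -> X -> R) (w x y : X) : R :=
  (d x w + d y w - d x y) / 2.

Definition gromov_hyperbolic (X : Type) (d : X -> X -> R) : Prop :=
  exists2 delta : R, 0 <= delta & forall x y z w : X,
    Num.min (gromov_product d w x z) (gromov_product d w z y) - delta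
      <= gromov_product d w x y.

Definition hyperbolic_group (G : groupType) : Prop :=
  exists2 S : set G, finite_generating S & gromov_hyperbolic (word_dist S).

End Hyperbolicity.

(* A probability measure on a countable set X is given by its mass function
   X -> R; the measure of a set A is then mass_of nu A. *)
Section Measures.
Variable R : realType.

Definition mass_of (X : choiceType) (nu : X -> R) (A : set X) : \bar R :=
  (\esum_(x in A) (nu x)%:E)%R.

Definition is_probability (X : choiceType) (nu : X -> R) : Prop :=
  (forall x, 0 <= nu x) /\ mass_of nu [set: X] = 1%E.

Definition tv_dist (X : choiceType) (nu1 nu2 : X -> R) : \bar R :=
  ereal_sup [set `|mass_of nu1 A - mass_of nu2 A|%E | A in [set: set X]].

Definition prod_mass (X Y : Type) (f : X -> R) (g : Y -> R) (p : X * Y) : R :=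
  f p.1 * g p.2.

Definition diag_mass (X : choiceType) (f : X -> R) (p : X * X) : R :=
  if p.1 == p.2 then f p.1 else 0.

Definition noise_mass (X : choiceType) (rho : R) (f : X -> R) (p : X * X) : R :=
  rho * prod_mass f f p + (1 - rho) * diag_mass f p.

(* The law of x * y for independent x and y with laws f and g. *)
Definition convolution (G : groupType) (f g : G -> R) (z : G) : R :=
  fine (\esum_(p in [set p : G * G | (p.1 * p.2)%g = z])
          (prod_mass f g p)%:E)%R.

(* The law of x_1 * ... * x_n for independent x_i with law f; a Dirac mass at
   the identity when n = 0. *)
Fixpoint convolution_power (G : groupType) (f : G -> R) (n : nat) : G -> R :=
  if n is m.+1 then convolution (convolution_power f m) f
  else fun x => (x == 1%g)%:R.

Definition support_of (X : Type) (f : X -> R) : set X := [set x | 0 < f x].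

Definition nonelementary (G : groupType) (mu : G -> R) : Prop :=
  ~ elementary (gen_subgroup (support_of mu)).

Definition finite_first_moment (G : groupType) (mu : G -> R) : Prop :=
  exists2 S : set G, finite_generating S &
    ((\esum_(x in [set: G]) ((word_norm S x)%:R * mu x)%:E)%R < +oo)%E.

End Measures.

(* Main.v *)
Require Import Defs.
From HB Require Import structures.
From mathcomp Require Import finmap.
From mathcomp Require Import all_boot all_order all_algebra.
From mathcomp Require Import all_classical all_reals all_analysis.
From mathcomp Require Import lra zify.

Set Implicit Arguments.
Unset Strict Implicit.
Unset Printing Implicit Defensive.

Import Order.TTheory GRing.Theory Num.Theory.
Import numFieldNormedType.Exports.

Local Open Scope classical_set_scope.
Local Open Scope ring_scope.

(** Write H for Shannon entropy, mu_n for the law of the walk w_n, and h for its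
    asymptotic entropy, the infimum of H (mu_n) / n. The walk with steps mu x mu
    has asymptotic entropy 2 h. The two coordinates of the noisy pair share most
    of their steps when rho is small, and its asymptotic entropy is then close
    to h. If h > 0 the two rates differ, and entropy rates govern the number of
    points that carry a walk: with c strictly between the two rates, the noisy
    pair is at time n in a set of exp (n c) points with probability close to 1,
    whereas such a set has negligible mass for mu_n x mu_n.

    Concentration. By the weak law of large numbers along blocks of steps, a walk
    is found in a set of exp (n c) points as soon as the cross entropy of one
    block with some reference law is below c per step (typical_set_upper). In the
    other direction, - ln mu_n (w_n) is at most the sum of the same quantity over
    blocks, a sum which concentrates, and its mean is at least n h; so it cannot be
    much smaller than n h either (block_concentration, small_sets_negligible).

    Noise. For one block of length k, the reference law that puts half of its mass
    on the diagonal copy of mu_k and half on mu_k x mu_k has cross entropy at most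
    H (mu_k) + ln 2 + k rho H (mu_k) with the noisy pair (noise_cross_entropy).
    With k large and then rho small this is below 7/4 k h. Times that are not
    multiples of k are reached backwards, since the noisy pair dominates
    rho^s (mu_s x mu_s) over s steps (separate_earlier).

    Positivity of h. The increment of H (mu_n) at time n is the mean divergence of
    the law of x w_n from that of w_(n+1), for a random step x. If h = 0, Pinsker's
    inequality makes the Cesaro averages of the mu_n asymptotically invariant, and
    an ultralimit is a finitely additive mean on all subsets of the group,
    invariant under the subgroup generated by the support
    (zero_rate_invariant_mean). In a hyperbolic group, a subgroup with such a mean
    is elementary (invariant_mean_elementary): for g in the subgroup, the half-way
    shadow of g^-1 and a translate of that of g cover the group, so one of the two
    shadows has mean at least 1/2. If g goes to infinity and its limit has at least
    three images under the subgroup, three translates of the shadow of g are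
    disjoint, and its mean is at most 1/3; likewise for g^-1. So one of the two
    limits has a stabiliser of index at most two, and stabilisers of points at
    infinity are virtually cyclic: the Busemann function is a quasimorphism on
    them, and only finitely many elements have a bounded value
    (small_drift_finite, stab_elementary).

    The entropies are finite because the first moment is (first_moment_entropy). *)

(** * Subgroups and word norms *)

Section Subgroups.
Variable G : groupType.
Implicit Types (A H : set G) (x y : G).

Definition is_subgroup H := H 1%g /\ forall x y, H x -> H y -> H (x * y^-1)%g.

Lemma is_subgroupP H : group_closed [in H] <-> is_subgroup H.
Proof.
split=> -[h1 hD]; split.
- by move: h1; rewrite inE.
- by move=> x y Hx Hy; have := hD x y; rewrite !inE; apply.
- by rewrite inE.
- by move=> x y; rewrite !inE; apply: hD.
Qed.

Lemma subgroupV H x : is_subgroup H -> H x -> H x^-1%g.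
Proof. by move=> [h1 hD] Hx; rewrite -(mul1g x^-1%g); apply: hD. Qed.

Lemma subgroupM H x y : is_subgroup H -> H x -> H y -> H (x * y)%g.
Proof.
by move=> sH Hx Hy; rewrite -(invgK y); apply: sH.2 => //; apply: subgroupV.
Qed.

Lemma gen_subgroup_is_subgroup A : is_subgroup (gen_subgroup A).
Proof.
split=> [|x y Ax Ay] H [/is_subgroupP sH AH]; first exact: sH.1.
by apply: sH.2; [apply: Ax|apply: Ay]; split=> //; apply/is_subgroupP.
Qed.

Lemma sub_gen_subgroup A : A `<=` gen_subgroup A.
Proof. by move=> x Ax H [_]; apply. Qed.

Lemma gen_subgroup_min A H : is_subgroup H -> A `<=` H -> gen_subgroup A `<=` H.
Proof. by move=> sH AH x; apply; split=> //; apply/is_subgroupP. Qed.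

End Subgroups.

Section WordNorm.
Variables (G : groupType) (S : set G).
Hypothesis fgS : finite_generating S.
Implicit Types (x y : G) (n : nat).
Local Notation len := (word_norm S).

Lemma is_wordM x y m n :
  is_word S x m -> is_word S y n -> is_word S (x * y)%g (m + n).
Proof.
move=> [u [<- uS <-]] [v [<- vS <-]]; exists (u ++ v); split.
- by rewrite size_cat.
- by move=> s; rewrite mem_cat => /orP[/uS|/vS].
- by rewrite big_cat.
Qed.

Lemma is_wordV x n : is_word S x n -> is_word S x^-1%g n.
Proof.
move=> [u [<- uS <-]]; exists [seq s^-1%g | s <- rev u]; split.
- by rewrite size_map size_rev.
- move=> _ /mapP[s + ->]; rewrite mem_rev invgK => /uS[]; [by right|by left].
- by rewrite big_map prodgV revK.
Qed.

Lemma is_word_exists x : exists n, is_word S x n.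
Proof.
have [_ gS] := fgS.
suff: gen_subgroup S `<=` [set x | exists n, is_word S x n].
  by rewrite gS => /(_ x); apply.
apply: gen_subgroup_min.
  split; first by exists 0%N, [::]; split=> //; rewrite big_nil.
  move=> {}x y [m xm] [n yn]; exists (m + n)%N.
  by apply: is_wordM => //; apply: is_wordV.
move=> s Ss; exists 1%N, [:: s]; split=> //; last by rewrite big_seq1.
by move=> t; rewrite inE => /eqP ->; left.
Qed.

Lemma word_normP x : is_word S x (len x).
Proof.
rewrite /word_norm; case: pselect => [ex|[]].
  by case: ex_minnP => n /asboolP.
by have [n xn] := is_word_exists x; exists n; apply/asboolP.
Qed.

Lemma word_norm_le x n : is_word S x n -> (len x <= n)%N.
Proof.
rewrite /word_norm; case: pselect => // ex xn.
by case: ex_minnP => m _; apply; apply/asboolP.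
Qed.

Lemma word_norm1 : len 1%g = 0%N.
Proof.
apply/eqP; rewrite -leqn0; apply: word_norm_le.
by exists [::]; split=> //; rewrite big_nil.
Qed.

Lemma word_normM x y : (len (x * y)%g <= len x + len y)%N.
Proof. by apply/word_norm_le/is_wordM; apply: word_normP. Qed.

Lemma word_normV x : len x^-1%g = len x.
Proof.
have le z : (len z^-1%g <= len z)%N by apply/word_norm_le/is_wordV/word_normP.
by apply/eqP; rewrite eqn_leq le -{1}(invgK x) le.
Qed.

(** Prefixes of a shortest word are shortest: the word metric has points at
    every distance along a geodesic. *)
Lemma word_norm_geodesic x n : (n <= len x)%N ->
  exists q, len q = n /\ len (q^-1 * x)%g = (len x - n)%N.
Proof.
move=> nx; have [w [sw wS wx]] := word_normP x.
exists (\prod_(s <- take n w) s)%g.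
have wE : (\prod_(s <- take n w) s * \prod_(s <- drop n w) s)%g = x.
  by rewrite -big_cat cat_take_drop.
have q1 : (len (\prod_(s <- take n w) s)%g <= n)%N.
  apply: word_norm_le; exists (take n w); split=> //.
    by rewrite size_take_min sw; apply/minn_idPl.
  by move=> s /mem_take/wS.
have q2 : (len (\prod_(s <- drop n w) s)%g <= len x - n)%N.
  apply: word_norm_le; exists (drop n w); split=> //.
    by rewrite size_drop sw.
  by move=> s /mem_drop/wS.
have := word_normM (\prod_(s <- take n w) s)%g (\prod_(s <- drop n w) s)%g.
rewrite wE; have -> : ((\prod_(s <- take n w) s)^-1 * x)%g = (\prod_(s <- drop n w) s)%g.
  by rewrite -[in LHS]wE mulKg.
lia.
Qed.

Lemma word_norm_ball_finite n : finite_set [set x | (len x <= n)%N].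
Proof.
have [finS _] := fgS.
pose T : set G := S `|` [set s^-1%g | s in S].
have finT : finite_set T.
  by rewrite finite_setU; split=> //; apply: finite_image.
elim: n => [|n IHn].
  apply: (@sub_finite_set _ _ [set 1%g]); last exact: finite_set1.
  move=> x /=; rewrite leqn0 => /eqP x0; have [w []] := word_normP x.
  by rewrite x0 => /size0nil -> _ <-; rewrite big_nil.
pose B := [set x | (len x <= n)%N].
apply: (@sub_finite_set _ _ ([set 1%g] `|` [set (p.1 * p.2)%g | p in T `*` B])).
  move=> x /= xn; have [w [sw wS wx]] := word_normP x.
  case: w => [|s w] in sw wS wx *; first by left; rewrite -wx big_nil.
  right; exists (s, \prod_(t <- w) t)%g; last by rewrite -wx big_cons.
  split=> /=.
    have /wS[Ss|Ss] : s \in s :: w by rewrite mem_head.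
      by left.
    by right; exists s^-1%g; rewrite ?invgK.
  have wn : (size w <= n)%N by rewrite -ltnS -[(size w).+1]/(size (s :: w)) sw.
  apply: leq_trans wn; apply: word_norm_le; exists w; split=> // t tw.
  by apply: wS; rewrite inE tw orbT.
rewrite finite_setU; split; first exact: finite_set1.
by apply: finite_image; apply: finite_setX.
Qed.

End WordNorm.

(** * Gromov products and stabilisers of points at infinity *)

Section UltraFilterFacts.

(** An ultrafilter selects one cell of a finite partition. *)
Lemma ultra_bounded_nat (T : Type) (w : set_system T) (f : T -> nat) n :
  UltraFilter w -> (\forall k \near w, (f k < n)%N) ->
  exists v, \forall k \near w, f k = v.
Proof.
move=> Uw; elim: n => [|n IHn] fn; first by have [k] := filter_ex fn.
have [ltn|gen] := in_ultra_setVsetC [set k | (f k < n)%N] Uw; first exact: IHn.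
exists n; near=> k; apply/eqP; rewrite eqn_leq -ltnS; apply/andP; split.
  by near: k.
by rewrite leqNgt; apply/negP; near: k; exact: gen.
Unshelve. all: by end_near. Qed.

End UltraFilterFacts.

Section Hyperbolic.
Variables (R : realType) (G : groupType) (S : set G) (delta : R).
Hypothesis fgS : finite_generating S.
Hypothesis delta0 : 0 <= delta.
Hypothesis hypd : forall x y z w : G,
  Num.min (gromov_product (word_dist R S) w x z)
          (gromov_product (word_dist R S) w z y) - delta
      <= gromov_product (word_dist R S) w x y.
Local Notation len := (word_norm S).
Local Notation d := (word_dist R S).
Local Notation ell x := ((len x)%:R : R).
Implicit Types (a b h k q x y z : G) (w : set_system G) (E H : set G).

Definition gprod x y : R := gromov_product d 1%g x y.

Lemma word_dist_sym x y : d x y = d y x.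
Proof. by rewrite /word_dist -(word_normV fgS) invgM invgK. Qed.

Lemma word_distM a x y : d (a * x)%g (a * y)%g = d x y.
Proof. by rewrite /word_dist invgM -mulgA mulKg. Qed.

Lemma word_dist1 x : d x 1%g = ell x.
Proof. by rewrite /word_dist mulg1 word_normV. Qed.

Lemma word_dist1l x : d 1%g x = ell x.
Proof. by rewrite word_dist_sym word_dist1. Qed.

Lemma word_dist_tri y x z : d x z <= d x y + d y z.
Proof.
rewrite /word_dist -natrD ler_nat.
by have := word_normM fgS (x^-1 * y)%g (y^-1 * z)%g; rewrite -mulgA mulVKg.
Qed.

Lemma gprodE x y : gprod x y = (ell x + ell y - d x y) / 2.
Proof. by rewrite /gprod /gromov_product !word_dist1. Qed.

Lemma gprod_sym x y : gprod x y = gprod y x.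
Proof. by rewrite !gprodE word_dist_sym addrC [ell y + _]addrC addrC. Qed.

Lemma gprod_le x y : gprod x y <= ell x.
Proof.
have := word_dist_tri x y 1%g; rewrite !word_dist1 gprodE word_dist_sym; lra.
Qed.

Lemma gprod_hyp M z x y : M <= gprod x z -> M <= gprod z y ->
  M - delta <= gprod x y.
Proof.
move=> xz zy; apply: le_trans (hypd x y z 1%g).
by rewrite lerB// le_min -/(gprod x z) -/(gprod z y) xz.
Qed.

(** The Gromov product of a x and a y is that of x and y seen from a^-1, and
    moving the base point by |a| changes it by at most |a|. *)
Lemma gprodM a x y : gprod x y - ell a <= gprod (a * x)%g (a * y)%g.
Proof.
have ax z : ell z <= ell a + ell (a * z)%g.
  have := word_normM fgS a^-1%g (a * z)%g.
  by rewrite mulKg (word_normV fgS) -natrD ler_nat.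
rewrite !gprodE word_distM; have := ax x; have := ax y; lra.
Qed.

(** Left translation by g turns the distance from x to g^-1 into |g x| and that
    from g x to g into |x|, and everything but |g| cancels. Hence no point avoids
    both the half-way shadow of g^-1 and, once moved by g, that of g. *)
Lemma gprod_cover g x : gprod (g * x)%g g + gprod x g^-1%g = ell g.
Proof.
rewrite !gprodE (word_normV fgS).
have -> : d (g * x)%g g = ell x.
  by rewrite -{2}(mulg1 g) word_distM word_dist1.
have -> : d x g^-1%g = ell (g * x)%g.
  by rewrite -(word_distM g) mulgV word_dist1.
by lra.
Qed.

Section Escaping.
Variable w : set_system G.
Context {Uw : UltraFilter w}.
Hypothesis esc : forall n, \forall k \near w, (n < len k)%N.

Lemma escape_real (M : R) : \forall k \near w, M < ell k.
Proof.
have [n Mn] : exists n : nat, M < n%:R.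
  by exists (Num.truncn `|M|).+1; rewrite (le_lt_trans (ler_norm M))// truncnS_gt.
by apply: filterS (esc n) => k; rewrite -(ltr_nat R); apply: lt_trans.
Qed.

(** The ultrafilter w stands for a point at infinity, and a fixes that point
    when a k and k have Gromov products beyond every bound along w. *)
Definition stab : set G :=
  [set a | forall M : R, \forall k \near w, M <= gprod (a * k)%g k].

Lemma stab_subgroup : is_subgroup stab.
Proof.
split=> [M|a b Ea Eb M].
  apply: filterS (escape_real M) => k Mk; rewrite mul1g gprodE /word_dist mulVg.
  by rewrite word_norm1// subr0; lra.
pose c := (a * b^-1)%g.
have := Ea (M + delta); have := Eb (M + delta + ell c); apply: filterS2 => k kb ka.
rewrite -(addrK delta M) -/c; apply: (gprod_hyp (z := (a * k)%g)) => //.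
have := gprodM c (b * k)%g k.
have -> : (c * (b * k))%g = (a * k)%g by rewrite /c mulgA mulgVK.
by rewrite (gprod_sym (c * k)%g); lra.
Qed.

(** The limit v of |a k| - |k| is the value at a^-1 of a Busemann function of
    the point at infinity. *)
Definition is_drift a (v : int) :=
  \forall k \near w, ell (a * k)%g - ell k = v%:~R.

(** The integer |a k| - |k| stays between - |a| and |a|. *)
Lemma drift_exists a : exists v, is_drift a v.
Proof.
have le k : (len (a * k)%g <= len a + len k)%N by apply: word_normM.
have le' k : (len k <= len a + len (a * k)%g)%N.
  by rewrite -{1}(mulKg a k) -(word_normV fgS a) word_normM.
have bd : \forall k \near w, (len a + len (a * k)%g - len k < (len a).*2.+1)%N.
  by near=> k; have := le k; have := le' k; lia.
have [v wv] := ultra_bounded_nat Uw bd.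
exists (v%:Z - (len a)%:Z); apply: filterS wv => k kv.
have kv' : (len a + len (a * k)%g = v + len k)%N.
  by rewrite -kv subnK// le'.
have : ell a + ell (a * k)%g = v%:R + ell k by rewrite -!natrD kv'.
  by rewrite intrB -!pmulrn; lra.
Unshelve. all: by end_near. Qed.

Definition drift a : int := xget 0 [set v | is_drift a v].

Lemma driftP a : is_drift a (drift a).
Proof. exact: (xgetPex 0 (drift_exists a)). Qed.

(** One has |a x| - |x| = |a| - 2 (x | a^-1). When b fixes the point at infinity,
    b k and k have the same Gromov product with a^-1 up to delta. *)
Lemma drift_quasi a b : stab b ->
  `|(drift (a * b)%g - drift a - drift b)%:~R : R| <= 2 * delta.
Proof.
move=> Eb.
have near_ev : \forall k \near w,
    `|(drift (a * b)%g - drift a - drift b)%:~R : R| <= 2 * delta.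
  near=> k.
  have h1 : ell (a * b * k)%g - ell k = (drift (a * b)%g)%:~R.
    by near: k; exact: driftP.
  have h2 : ell (a * k)%g - ell k = (drift a)%:~R by near: k; exact: driftP.
  have h3 : ell (b * k)%g - ell k = (drift b)%:~R by near: k; exact: driftP.
  have hk : ell a <= gprod (b * k)%g k by near: k; exact: Eb.
  have aE z : ell (a * z)%g - ell z = ell a - 2 * gprod z a^-1%g.
    by rewrite -(word_normV fgS a) gprodE -(word_distM a) mulgV word_dist1; lra.
  have gle z : gprod z a^-1%g <= ell a.
    by rewrite gprod_sym (le_trans (gprod_le _ _))// word_normV.
  have g1 : gprod k a^-1%g - delta <= gprod (b * k)%g a^-1%g.
    by apply: (gprod_hyp (z := k)) => //; apply: le_trans hk.
  have g2 : gprod (b * k)%g a^-1%g - delta <= gprod k a^-1%g.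
    apply: (gprod_hyp (z := (b * k)%g)) => //; rewrite (gprod_sym k).
    exact: le_trans hk.
  rewrite !intrB -h1 -h2 -h3 -mulgA ler_norml.
  have := aE (b * k)%g; have := aE k; lra.
by have [k] := filter_ex near_ev.
Unshelve. all: by end_near. Qed.

(** The geodesics that go from 1 and from a to a point at infinity fixed by a
    merge, up to a multiple of delta, with a time lag equal to the drift of a.
    How late this happens depends on a through t, but how close the geodesics
    get does not, and small_drift_finite rests on this uniformity. *)
Lemma stab_small_displacement a c (t : nat) : stab a ->
  `|(drift a)%:~R : R| <= c -> ell a + delta < t%:R ->
  \forall k \near w, (t < len k)%N /\
    forall q, len q = t -> len (q^-1 * k)%g = (len k - t)%N ->
      d (a * q)%g q <= c + 8 * delta.
Proof.
move=> Ea; rewrite ler_norml => /andP[c1 c2] ta; near=> k.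
have tk : (t < len k)%N by near: k.
split=> // q qt qk.
have hs : ell (a * k)%g - ell k = (drift a)%:~R by near: k; exact: driftP.
have hk : t%:R + ell a <= gprod (a * k)%g k by near: k; exact: Ea.
have ql : ell q = t%:R by rewrite qt.
have dqk : d q k = ell k - t%:R by rewrite /word_dist qk natrB// ltnW.
have gqk : gprod q k = t%:R by rewrite gprodE ql dqk; lra.
pose s := ell (a * q)%g.
have aqa : d (a * q)%g a = t%:R.
  by rewrite -[X in d _ X](mulg1 a) word_distM word_dist1.
have aka : d (a * k)%g a = ell k.
  by rewrite -[X in d _ X](mulg1 a) word_distM word_dist1.
have aqak : d (a * q)%g (a * k)%g = ell k - t%:R by rewrite word_distM.
have [s1 s2] : s - t%:R <= ell a /\ t%:R - s <= ell a.
  have := word_dist_tri a (a * q)%g 1%g; have := word_dist_tri 1%g (a * q)%g a.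
  by rewrite !word_dist1l !word_dist1 aqa -/s; lra.
(* From a q, the points a and a k lie in opposite directions, and 1 lies in the
   direction of a because q is far from 1. *)
have ends : gromov_product d (a * q)%g 1%g (a * k)%g <= delta.
  have := hypd a (a * k)%g 1%g (a * q)%g.
  have -> : gromov_product d (a * q)%g a (a * k)%g = 0.
    rewrite /gromov_product (word_dist_sym (a * k)%g (a * q)%g) aqak.
    by rewrite (word_dist_sym a (a * k)%g) aka (word_dist_sym a) aqa; lra.
  have lt : delta < gromov_product d (a * q)%g a 1%g.
    by rewrite /gromov_product (word_dist_sym a) aqa word_dist1l word_dist1 -/s; lra.
  rewrite subr_le0 ge_min => /orP[le|//].
  by have := lt_le_trans lt le; rewrite ltxx.
move: ends; rewrite /gromov_product word_dist1l (word_dist_sym (a * k)%g) aqak.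
rewrite word_dist1l -/s => ends.
have gak : s - delta <= gprod (a * q)%g (a * k)%g.
  by rewrite gprodE aqak -/s; lra.
have sshift : s - t%:R <= (drift a)%:~R + 2 * delta by rewrite -hs; lra.
have sshift' : (drift a)%:~R <= s - t%:R.
  have := word_dist_tri (a * q)%g (a * k)%g 1%g.
  by rewrite !word_dist1 word_dist_sym aqak -hs -/s; lra.
(* The smaller of the two available bounds on the Gromov products at 1. *)
have [m [ms [mt mE]]] : exists m, [/\ m <= s - delta, m <= t%:R &
    s + t%:R - 2 * m <= c + 4 * delta].
  by have [le|le] := leP (s - delta) t%:R; [exists (s - delta)|exists t%:R]; split=> //; lra.
have g1 : m - delta <= gprod (a * q)%g k.
  apply: (gprod_hyp (z := (a * k)%g)); first exact: le_trans gak.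
  apply: le_trans hk; lra.
have g2 : m - delta - delta <= gprod (a * q)%g q.
  apply: (gprod_hyp (z := k)) => //; rewrite gprod_sym gqk; lra.
move: g2; rewrite gprodE -/s ql; lra.
Unshelve. all: by end_near. Qed.

End Escaping.
End Hyperbolic.

(** * Invariant means on hyperbolic groups *)

Section Elementary.
Variable G : groupType.
Implicit Types (E H : set G) (a c h x u : G).

Lemma finite_elementary E : is_subgroup E -> finite_set E -> elementary E.
Proof.
move=> sE finE; exists 1%g.
have g1 : gen_subgroup [set 1%g] `<=` [set 1%g : G].
  apply: gen_subgroup_min => //; split=> // x y -> ->.
  by rewrite /= invg1 mulg1.
have s1 := gen_subgroup_is_subgroup [set (1%g : G)].
split; first by move=> x /g1 ->; exact: sE.1.
exists E; split=> //; apply/seteqP; split=> [x Ex|x [f Ef [k /g1 -> <-]]].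
  by exists x => //; exists 1%g; [exact: s1.1|rewrite mulg1].
by rewrite mulg1.
Qed.

(** Here E has index at most two in H, with left cosets E and a E. *)
Lemma elementary_overgroup E H a : is_subgroup H -> E `<=` H -> H a ->
  (forall c, H c -> E c \/ E (a^-1 * c)%g) -> elementary E -> elementary H.
Proof.
move=> sH EH Ha cov [g [gE [F [finF FE EF]]]]; exists g; split.
  exact: subset_trans gE EH.
exists (F `|` [set (a * f)%g | f in F]); split.
- by rewrite finite_setU; split=> //; apply: finite_image.
- move=> x [/FE/EH//|[f /FE/EH Hf <-]]; exact: subgroupM.
- apply/seteqP; split=> [x Hx|x [f Ff [k /gE/EH Hk <-]]].
    have [|] := cov x Hx; rewrite EF => -[f Ff [k gk]] fk.
      by exists f; [left|exists k].
    exists (a * f)%g; first by right; exists f.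
    by exists k => //; rewrite -mulgA fk mulVKg.
  apply: subgroupM => //; case: Ff => [/FE/EH//|[f' /FE/EH Hf <-]].
  exact: subgroupM.
Qed.

End Elementary.

(** One of the two steps by T or by - T, each known up to 2 D, brings A closer
    to 0 as soon as |A| exceeds |T| + 2 D. *)
Lemma step_not_improving (R : realType) (D A B C T : R) :
  2 * D < `|T| -> `|T| + 2 * D < `|A| -> `|B - A - T| <= 2 * D ->
  `|A - C - T| <= 2 * D -> `|A| <= `|B| -> `|A| <= `|C| -> False.
Proof.
move=> h1 h2; rewrite (ler_norml (B - A - T)) (ler_norml (A - C - T)).
move: h1 h2; case: (ger0P A) => ?; case: (ger0P B) => ?; case: (ger0P C) => ?;
  case: (ger0P T) => ? *; lra.
Qed.

Section StabElementary.
Variables (R : realType) (G : groupType) (S : set G) (delta : R).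
Hypothesis fgS : finite_generating S.
Hypothesis delta0 : 0 <= delta.
Hypothesis hypd : forall x y z w : G,
  Num.min (gromov_product (word_dist R S) w x z)
          (gromov_product (word_dist R S) w z y) - delta
      <= gromov_product (word_dist R S) w x y.
Variable w : set_system G.
Context {Uw : UltraFilter w}.
Hypothesis esc : forall n, \forall k \near w, (n < word_norm S k)%N.
Local Notation len := (word_norm S).
Local Notation d := (word_dist R S).
Local Notation ell x := ((len x)%:R : R).
Local Notation stab := (stab R S w).
Local Notation tau := (drift R S w).

(** Finitely many such a can all be tested at one point q far along a geodesic.
    Conjugation by q maps them injectively into a ball whose radius depends on c
    only, so their number is bounded by the size of that ball. *)
Lemma small_drift_finite (c : R) :
  finite_set [set a | stab a /\ `|(tau a)%:~R : R| <= c].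
Proof.
apply: contrapT => inf.
pose n := (Num.truncn `|c + 8 * delta|).+1.
have nP : c + 8 * delta <= n%:R.
  by apply: le_trans (ler_norm _) _; apply/ltW/truncnS_gt.
have finX := word_norm_ball_finite fgS n.
pose X := fset_set [set x | (len x <= n)%N].
have [B BE cB] := infinite_set_fset #|` X|.+1 inf.
pose t := (Num.truncn `|\sum_(a <- B) ell a + delta|).+1.
have tB a : a \in B -> ell a + delta < t%:R.
  move=> aB; apply: le_lt_trans (truncnS_gt _); apply: le_trans (ler_norm _).
  by rewrite lerD2r (big_fsetD1 a)//= lerDl sumr_ge0.
have nearB : \forall k \near w, forall a, a \in B -> (t < len k)%N /\
    forall q, len q = t -> len (q^-1 * k)%g = (len k - t)%N ->
      d (a * q)%g q <= c + 8 * delta.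
  apply: filter_bigI => a aB; have [Ea ca] := BE a aB.
  exact: (stab_small_displacement fgS delta0 hypd esc Ea ca (tB a aB)).
have [k kB] := filter_ex nearB.
have [a0 a0B] : exists a, a \in B.
  by apply/fset0Pn; rewrite -cardfs_gt0; apply: leq_ltn_trans cB.
have [tk _] := kB a0 a0B.
have [q [qt qk]] := word_norm_geodesic fgS (ltnW tk).
have sub : (B `<=` [fset (q * x * q^-1)%g | x in X])%fset.
  apply/fsubsetP => a aB; have [_ /(_ q qt qk) dq] := kB a aB.
  apply/imfsetP; exists (q^-1 * a * q)%g; last by rewrite /= !mulgA mulgV mul1g mulgK.
  rewrite /= in_fset_set//; apply/mem_set.
  rewrite /= -(ler_nat R); apply: le_trans nP.
  by apply: le_trans dq; rewrite (word_dist_sym R fgS) /word_dist mulgA.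
have := leq_trans (fsubset_leq_card sub) (leq_imfset_card _ _ _).
by rewrite leqNgt cB.
Qed.

(** If all drifts on E are at most 2 delta in absolute value, E is finite. Otherwise E contains some
    h of larger drift; right multiplication by h or its inverse brings any large
    drift closer to 0, so each left coset of the cyclic group generated by h
    meets the finite set of elements of small drift. *)
Lemma stab_elementary E : is_subgroup E -> E `<=` stab -> elementary E.
Proof.
move=> sE Es.
have [[h Eh hd]|small] := pselect (exists2 h, E h & 2 * delta < `|(tau h)%:~R : R|);
    last first.
  apply: finite_elementary => //.
  apply: sub_finite_set (small_drift_finite (2 * delta)) => a Ea.
  split; first exact: Es.
  by rewrite leNgt; apply/negP => lt; apply: small; exists a.
have gE : gen_subgroup [set h] `<=` E.
  by apply: gen_subgroup_min => // _ ->.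
have sg := gen_subgroup_is_subgroup [set h].
have gh : gen_subgroup [set h] h by apply: sub_gen_subgroup.
pose c : R := `|(tau h)%:~R| + 2 * delta.
pose F := [set a | E a /\ `|(tau a)%:~R : R| <= c].
exists h; split => //; exists F; split.
- by apply: sub_finite_set (small_drift_finite c) => a [/Es].
- by move=> a [].
apply/seteqP; split=> [x Ex|x [f [Ef _] [k /gE Ek <-]]]; last exact: (subgroupM sE Ef Ek).
(* Drifts are integers, so one of least absolute value occurs in the coset of x. *)
pose P n := `[< exists2 u, gen_subgroup [set h] u & `|tau (x * u)%g|%N = n >].
have exP : exists n, P n.
  by exists `|tau (x * 1)%g|%N; apply/asboolP; exists 1%g => //; exact: sg.1.
case: (ex_minnP exP) => n /asboolP[u gu un] nmin.
have {nmin}nmin v : gen_subgroup [set h] v ->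
    `|(tau (x * u)%g)%:~R| <= `|(tau (x * v)%g)%:~R| :> R.
  move=> gv; rewrite -!intr_norm ler_int -!abszE lez_nat un; apply: nmin.
  by apply/asboolP; exists v.
have Exu v : gen_subgroup [set h] v -> E (x * v)%g.
  by move=> /gE Ev; exact: (subgroupM sE Ex Ev).
exists (x * u)%g; last first.
  exists u^-1%g; first exact: (subgroupV sg gu).
  by rewrite mulgK.
split; first exact: Exu.
rewrite leNgt; apply/negP => big.
have gup : gen_subgroup [set h] (u * h)%g := subgroupM sg gu gh.
have gum : gen_subgroup [set h] (u * h^-1)%g := sg.2 _ _ gu gh.
have q1 := drift_quasi fgS delta0 hypd (Uw := Uw) (x * u)%g (Es _ Eh).
have q2 := drift_quasi fgS delta0 hypd (Uw := Uw) (x * (u * h^-1))%g (Es _ Eh).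
have e2 : (x * (u * h^-1) * h)%g = (x * u)%g by rewrite -!mulgA mulVg mulg1.
move: q1 q2; rewrite e2 -mulgA !intrB => q1 q2.
exact: (step_not_improving hd big q1 q2 (nmin _ gup) (nmin _ gum)).
Qed.

End StabElementary.

Section Mean.
Variables (R : realType) (G : groupType).
Implicit Types (H A B : set G) (m : set G -> R).

(** Invariance is stated for preimages under left translations; as H is a
    group, this is the invariance of m under left translates of A. *)
Definition invariant_mean H m :=
  [/\ m setT = 1, forall A, 0 <= m A,
      forall A B, A `&` B = set0 -> m (A `|` B) = m A + m B &
      forall a A, H a -> m [set x | A (a * x)%g] = m A].

Lemma mean_le H m A B : invariant_mean H m -> A `<=` B -> m A <= m B.
Proof.
move=> [_ m0 mU _] AB; have <- : A `|` (B `\` A) = B by rewrite setDUK.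
rewrite mU ?lerDl//; by rewrite setDE setICA setICr setI0.
Qed.

Lemma meanU_le H m A B : invariant_mean H m -> m (A `|` B) <= m A + m B.
Proof.
move=> im; have [_ m0 mU _] := im.
have -> : A `|` B = A `|` (B `\` A) by rewrite setDE setUIr setUCr setIT.
rewrite mU; last by rewrite setDE setICA setICr setI0.
by rewrite lerD2l; apply: (mean_le im) => x [].
Qed.

(** The three hypotheses on O say that O, a O and c O are pairwise disjoint. *)
Lemma mean_three_disjoint H m O a c : invariant_mean H m -> is_subgroup H ->
  H a -> H c ->
  (forall z, ~ (O z /\ O (a * z)%g)) -> (forall z, ~ (O z /\ O (c * z)%g)) ->
  (forall z, ~ (O z /\ O (a^-1 * c * z)%g)) -> 3 * m O <= 1.
Proof.
move=> im sH Ha Hc d1 d2 d3; have [m1 m0 mU mI] := im.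
have e1 : m [set x | O (a^-1 * x)%g] = m O by apply: mI; apply: subgroupV.
have e2 : m [set x | O (c^-1 * x)%g] = m O by apply: mI; apply: subgroupV.
have -> : 3 * m O = m ((O `|` [set x | O (a^-1 * x)%g]) `|` [set x | O (c^-1 * x)%g]).
  rewrite mU; last first.
    rewrite -subset0 => x [[Ox|/= Oax] /= Ocx].
      by apply: (d2 (c^-1 * x)%g); rewrite mulVKg.
    by apply: (d3 (c^-1 * x)%g); rewrite -mulgA mulVKg.
  rewrite mU ?e1 ?e2; first by lra.
  rewrite -subset0 => x [Ox /= Oax].
  by apply: (d1 (a^-1 * x)%g); rewrite mulVKg.
by rewrite -m1; apply: (mean_le im) => x _.
Qed.

End Mean.

Section MeanElementary.
Variables (R : realType) (G : groupType) (S : set G) (delta : R).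
Hypothesis fgS : finite_generating S.
Hypothesis delta0 : 0 <= delta.
Hypothesis hypd : forall x y z w : G,
  Num.min (gromov_product (word_dist R S) w x z)
          (gromov_product (word_dist R S) w z y) - delta
      <= gromov_product (word_dist R S) w x y.
Local Notation len := (word_norm S).
Local Notation ell x := ((len x)%:R : R).
Local Notation gprod := (gprod R S).

(** The points y such that the geodesics from 1 to y and from 1 to k run
    together for half of the way to k. *)
Definition shadow (k : G) : set G := [set y | ell k / 2 <= gprod y k].

(** If z and b z both lie in the shadow of k, then b k and k are both close to
    the direction of b z, so their Gromov product is about |k| / 2 at least. When
    b moves the point at infinity this product stays bounded along w. *)
Lemma shadow_disjoint (w : set_system G) b : UltraFilter w ->
  (forall n, \forall k \near w, (n < len k)%N) -> ~ stab R S w b ->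
  \forall k \near w, forall z, ~ (shadow k z /\ shadow k (b * z)%g).
Proof.
move=> Uw esc /existsNP[M nM].
have : \forall k \near w, gprod (b * k)%g k < M.
  have [//|nk] := in_ultra_setVsetC [set k | M <= gprod (b * k)%g k] Uw.
  by apply: filterS nk => k /= /negP; rewrite -ltNge.
apply: filterS2 (escape_real esc (2 * (M + ell b + delta))) => k big lt z [Oz Obz].
have h1 := gprodM R fgS b z k.
have h2 : ell k / 2 - ell b <= gprod (b * k)%g (b * z)%g.
  rewrite (gprod_sym R fgS); move: Oz; rewrite /shadow /=; lra.
have h3 : ell k / 2 - ell b <= gprod (b * z)%g k.
  by move: Obz; rewrite /shadow /= => h; apply: le_trans h; rewrite lerBlDr lerDl.
have := gprod_hyp hypd h2 h3; lra.
Qed.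

(** An ultrafilter finer than the cofinite filter of H leaves every ball,
    because balls are finite. *)
Lemma infinite_escape (H : set G) : ~ finite_set H ->
  exists w, [/\ UltraFilter w, w H & forall n, \forall k \near w, (n < len k)%N].
Proof.
move=> infH.
pose F : set_system G := [set A | finite_set (H `\` A)].
have FF : ProperFilter F.
  split; first by rewrite /F /= setD0.
  split.
  - by rewrite /F /= setDT; exact: finite_set0.
  - move=> A B FA FB; rewrite /F /= setDIr finite_setU; split=> //.
  - move=> A B AB; apply: sub_finite_set; exact: setDS.
have [w [Uw Fw]] := ultraFilterLemma FF.
exists w; split => //.
  by apply: Fw; rewrite /F /= setDv; exact: finite_set0.
move=> n; apply: Fw; apply: sub_finite_set (word_norm_ball_finite fgS n).
by move=> k [_ /negP]; rewrite -leqNgt.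
Qed.

(** In the absence of such a triple, the stabiliser of the point at infinity has
    at most two left cosets in H. *)
Lemma index_le2_elementary (w : set_system G) (H : set G) : UltraFilter w ->
  (forall n, \forall k \near w, (n < len k)%N) -> is_subgroup H ->
  ~ (exists a c, [/\ H a, H c, ~ stab R S w a, ~ stab R S w c &
      ~ stab R S w (a^-1 * c)%g]) -> elementary H.
Proof.
move=> Uw esc sH nbad.
have ss : is_subgroup (stab R S w) by apply: stab_subgroup.
have [all|/existsNP[a /not_implyP[Ha na]]] := pselect (H `<=` stab R S w).
  exact: (stab_elementary fgS delta0 hypd esc).
have sE : is_subgroup (H `&` stab R S w).
  split; first by split; [exact: sH.1|exact: ss.1].
  by move=> x y [? ?] [? ?]; split; [exact: sH.2|exact: ss.2].
apply: (elementary_overgroup sH _ Ha (E := H `&` stab R S w)).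
- by move=> x [].
- move=> c Hc; have [sc|nc] := pselect (stab R S w c); first by left.
  right; split; first by apply: subgroupM => //; apply: subgroupV.
  by apply: contrapT => nac; apply: nbad; exists a, c.
- by apply: (stab_elementary fgS delta0 hypd esc) => // x [].
Qed.

(** Let g go to infinity in H. Its limit is seen by w, and that of g^-1 by the
    image w' of w under inversion. If neither limit had an H-stabiliser of index
    at most two, the shadows of g and of g^-1 would eventually have mean at most
    1/3 each, as three disjoint translates fit; but by gprod_cover the group is
    the union of the shadow of g^-1 and a translate of that of g. *)
Theorem invariant_mean_elementary (H : set G) (m : set G -> R) :
  is_subgroup H -> invariant_mean H m -> elementary H.
Proof.
move=> sH im; have [finH|infH] := pselect (finite_set H).
  exact: finite_elementary.
have [w [Uw wH esc]] := infinite_escape infH.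
pose w' : set_system G := [set [set x^-1%g | x in A] | A in w].
have Uw' : UltraFilter w'.
  apply: ultra_image; apply/seteqP; split=> // x _.
  by exists x^-1%g => //; rewrite invgK.
have w'w (P : set G) : w' P -> \forall k \near w, P k^-1%g.
  by move=> [A wA <-]; apply: filterS wA => k Ak; exists k.
have esc' n : \forall k \near w', (n < len k)%N.
  exists [set k | (n < len k)%N]; first exact: esc.
  apply/seteqP; split=> [_ [k nk <-]|k nk] /=; first by rewrite (word_normV fgS).
  by exists k^-1%g; rewrite ?invgK //= (word_normV fgS).
apply: contrapT => nel.
have bad v : UltraFilter v -> (forall n, \forall k \near v, (n < len k)%N) ->
    \forall k \near v, 3 * m (shadow k) <= 1.
  move=> Uv escv; have [[a [c [Ha Hc na nc nac]]]|nbad] := pselect (exists a c,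
      [/\ H a, H c, ~ stab R S v a, ~ stab R S v c & ~ stab R S v (a^-1 * c)%g]);
    last by case: nel; exact: (index_le2_elementary Uv escv).
  have s1 := shadow_disjoint Uv escv na; have s2 := shadow_disjoint Uv escv nc.
  have s3 := shadow_disjoint Uv escv nac; near=> k.
  apply: (mean_three_disjoint im sH Ha Hc); near: k; first exact: s1.
    exact: s2.
  exact: s3.
have n1 := bad w Uw esc; have n2 := w'w _ (bad w' Uw' esc').
have [g [[Hg g1] g2]] := filter_ex (filterI (filterI wH n1) n2).
have [m1 m0 mU mI] := im.
have : m setT <= m (shadow g^-1%g) + m (shadow g).
  rewrite -(mI g (shadow g) Hg); apply: le_trans (meanU_le _ _ im).
  apply: (mean_le im) => x _; rewrite /shadow /=.
  have := gprod_cover R fgS g x.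
  have [le|lt] := leP (ell g^-1%g / 2) (gprod x g^-1%g); first by left.
  by right => /=; move: lt; rewrite (word_normV fgS); lra.
rewrite m1; move: g1 g2; rewrite /=; lra.
Unshelve. all: by end_near. Qed.

End MeanElementary.

(** * Expectations and convolution powers *)

Section Expectation.
Variable R : realType.
Local Open Scope ereal_scope.

Lemma esumZl (T : choiceType) (I : set T) (a : T -> \bar R) (c : \bar R) :
  0 <= c -> (forall i, I i -> 0 <= a i) ->
  \esum_(i in I) (c * a i) = c * \esum_(i in I) a i.
Proof.
move=> c0 a0.
have le r (b : T -> \bar R) : (0 <= r)%R -> (forall i, I i -> 0 <= b i) ->
    \esum_(i in I) (r%:E * b i) <= r%:E * \esum_(i in I) b i.
  move=> r0 b0; apply: ge_ereal_sup => _ [X [finX XI] <-].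
  rewrite !fsbig_finite//= [in leLHS]big_seq -ge0_sume_distrr; last first.
    by move=> i; rewrite in_fset_set// inE => /XI/b0.
  rewrite -big_seq -fsbig_finite//.
  rewrite lee_wpmul2l ?lee_fin//; apply: ereal_sup_ubound; by exists X.
case: c c0 => [r||] // c0.
- rewrite lee_fin in c0; apply/eqP; rewrite eq_le le//=.
  have [->|r0] := eqVneq r 0%R; first by rewrite mul0e esum_ge0// => i Ii; rewrite mul0e.
  have rgt : (0 < r)%R by rewrite lt_neqAle eq_sym r0.
  have r'0 : (0 <= r^-1)%R by rewrite invr_ge0.
  have ra0 i : I i -> 0 <= r%:E * a i by move=> Ii; rewrite mule_ge0 ?a0.
  have h : \esum_(i in I) a i <= (r^-1)%R%:E * \esum_(i in I) (r%:E * a i).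
    apply: le_trans (le _ _ r'0 ra0).
    by apply: le_esum => i Ii; rewrite muleA -EFinM mulVf// mul1e.
  have := lee_wpmul2l (_ : 0 <= r%:E) h; rewrite lee_fin => /(_ c0) /le_trans; apply.
  by rewrite muleA -EFinM mulfV// mul1e.
- have [[i Ii ai]|all0] := pselect (exists2 i, I i & a i != 0); last first.
    have z i : I i -> a i = 0.
      by move=> Ii; apply: contrapT => /eqP ai; apply: all0; exists i.
    by rewrite !esum1 ?mule0// => i /z ->; rewrite mule0.
  have aigt : 0 < a i by rewrite lt_neqAle eq_sym ai a0.
  have le1 (b : T -> \bar R) : (forall i, I i -> 0 <= b i) -> b i <= \esum_(i in I) b i.
    move=> b0; apply: esum_ge; exists [set i].
      by split=> [|_ ->]; [exact: finite_set1|].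
    by rewrite fsbig_set1.
  rewrite gt0_mulye; last exact: lt_le_trans (le1 a a0).
  apply/eqP; rewrite eq_le leey/=; apply: le_trans (le1 _ _).
    by rewrite gt0_mulye.
  by move=> j Ij; rewrite mule_ge0 ?a0 ?leey.
Qed.

(** Extended real values give every nonnegative function an expectation, so
    that sums can be exchanged freely. *)
Definition Ex (X : choiceType) (nu : X -> R) (phi : X -> \bar R) : \bar R :=
  \esum_(x in [set: X]) ((nu x)%:E * phi x).

Section Basic.
Variables (X : choiceType) (nu : X -> R).
Hypothesis pnu : is_probability nu.
Implicit Types (phi psi : X -> \bar R).

Lemma prob_ge0 x : (0 <= nu x)%R. Proof. exact: pnu.1. Qed.

Lemma Ex_ge0 phi : (forall x, 0 <= phi x) -> 0 <= Ex nu phi.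
Proof. by move=> p0; apply: esum_ge0 => x _; rewrite mule_ge0 ?lee_fin ?prob_ge0. Qed.

Lemma le_Ex phi psi : (forall x, (0 < nu x)%R -> phi x <= psi x) ->
  Ex nu phi <= Ex nu psi.
Proof.
move=> le; apply: le_esum => x _; have := prob_ge0 x.
rewrite le_eqVlt => /predU1P[<-|nx]; first by rewrite !mul0e.
by apply: lee_wpmul2l; [rewrite lee_fin ltW|exact: le].
Qed.

Lemma eq_Ex phi psi : (forall x, (0 < nu x)%R -> phi x = psi x) ->
  Ex nu phi = Ex nu psi.
Proof. by move=> e; apply/eqP; rewrite eq_le !le_Ex// => x /e ->. Qed.

Lemma ExD phi psi : (forall x, 0 <= phi x) -> (forall x, 0 <= psi x) ->
  Ex nu (fun x => phi x + psi x) = Ex nu phi + Ex nu psi.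
Proof.
move=> p0 q0; rewrite /Ex -esumD; last 2 first.
- by move=> x _; rewrite mule_ge0 ?lee_fin ?prob_ge0.
- by move=> x _; rewrite mule_ge0 ?lee_fin ?prob_ge0.
by apply: eq_esum => x _; rewrite ge0_muleDr.
Qed.

Lemma ExZ (c : \bar R) phi : 0 <= c -> (forall x, 0 <= phi x) ->
  Ex nu (fun x => c * phi x) = c * Ex nu phi.
Proof.
move=> c0 p0; rewrite /Ex -esumZl//; last first.
  by move=> x _; rewrite mule_ge0 ?lee_fin ?prob_ge0.
by apply: eq_esum => x _; rewrite muleCA.
Qed.

Lemma Ex_cst (c : \bar R) : 0 <= c -> Ex nu (fun=> c) = c.
Proof.
move=> c0; rewrite /Ex.
under eq_esum do rewrite muleC.
rewrite esumZl// ?(pnu.2) ?mule1//; first by rewrite [X in _ * X](pnu.2) mule1.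
by move=> x _; rewrite lee_fin prob_ge0.
Qed.

Lemma mass_of_Ex (A : set X) : mass_of nu A = Ex nu (fun x => (\1_A x)%:E).
Proof.
rewrite /mass_of esum_mkcond; apply: eq_esum => x _.
by rewrite indicE; case: ifP => _; rewrite ?mule1 ?mule0.
Qed.

Lemma mass_of_ge0 (A : set X) : 0 <= mass_of nu A.
Proof. by apply: esum_ge0 => x _; rewrite lee_fin prob_ge0. Qed.

Lemma mass_of_le (A B : set X) : A `<=` B -> mass_of nu A <= mass_of nu B.
Proof.
move=> AB; rewrite !mass_of_Ex; apply: le_Ex => x _; rewrite lee_fin !indicE.
by rewrite ler_nat; case: (boolP (x \in A)) => //; rewrite inE => /AB Bx; rewrite mem_set.
Qed.

Lemma mass_of_le1 (A : set X) : mass_of nu A <= 1.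
Proof. by rewrite -pnu.2; apply: mass_of_le. Qed.

Lemma mass_of_fin (A : set X) : mass_of nu A \is a fin_num.
Proof.
by rewrite ge0_fin_numE ?mass_of_ge0// (le_lt_trans (mass_of_le1 A))// ltry.
Qed.

Lemma mass_of_set1 x : mass_of nu [set x] = (nu x)%:E.
Proof. by rewrite /mass_of esum_set1// lee_fin prob_ge0. Qed.

Lemma prob_le1 x : (nu x <= 1)%R.
Proof. by rewrite -lee_fin -mass_of_set1 mass_of_le1. Qed.

Lemma mass_of_setC (A : set X) : mass_of nu A + mass_of nu (~` A) = 1.
Proof.
rewrite !mass_of_Ex -ExD; try by move=> x; rewrite lee_fin indicE.
rewrite -[RHS]Ex_cst//; apply: eq_Ex => x _; rewrite -EFinD !indicE in_setC.
by case: (x \in A); rewrite /= ?addr0 ?add0r.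
Qed.

End Basic.

(** Indicators of singletons recover the masses. *)
Lemma Ex_mass_ext (X : choiceType) (nu nu' : X -> R) :
  is_probability nu -> is_probability nu' ->
  (forall phi, (forall x, 0 <= phi x) -> Ex nu phi = Ex nu' phi) -> nu = nu'.
Proof.
move=> pn pn' e; apply/funext => x; apply: EFin_inj.
by rewrite -!mass_of_set1// !mass_of_Ex//; apply: e => y; rewrite lee_fin.
Qed.

Lemma Ex_prod (X Y : choiceType) (f : X -> R) (g : Y -> R) (phi : X * Y -> \bar R) :
  is_probability f -> is_probability g -> (forall p, 0 <= phi p) ->
  Ex (prod_mass f g) phi = Ex f (fun x => Ex g (fun y => phi (x, y))).
Proof.
move=> pf pg p0; rewrite /Ex.
under [RHS]eq_esum => x _.
  rewrite -esumZl; [|by rewrite lee_fin prob_ge0|]; last first.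
    by move=> y _; rewrite mule_ge0 ?lee_fin ?prob_ge0.
  over.
rewrite esum_esum; last first.
  by move=> x y _ _; rewrite !mule_ge0 ?lee_fin ?prob_ge0.
rewrite (_ : [set: X] `*`` (fun=> [set: Y]) = [set: X * Y]); last first.
  by apply/seteqP; split.
by apply: eq_esum => -[x y] _; rewrite /prod_mass /= EFinM muleA.
Qed.

Lemma prod_mass_prob (X Y : choiceType) (f : X -> R) (g : Y -> R) :
  is_probability f -> is_probability g -> is_probability (prod_mass f g).
Proof.
move=> pf pg; split; first by move=> p; rewrite mulr_ge0 ?prob_ge0.
transitivity (Ex (prod_mass f g) (fun=> 1)).
  by apply: eq_esum => x _; rewrite mule1.
by rewrite Ex_prod// !Ex_cst.
Qed.

Lemma Ex_swap (X Y : choiceType) (f : X -> R) (g : Y -> R) (phi : X -> Y -> \bar R) :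
  is_probability f -> is_probability g -> (forall x y, 0 <= phi x y) ->
  Ex f (fun x => Ex g (phi x)) = Ex g (fun y => Ex f (phi^~ y)).
Proof.
move=> pf pg p0.
rewrite -(@Ex_prod _ _ f g (fun p => phi p.1 p.2))//.
rewrite -(@Ex_prod _ _ g f (fun p => phi p.2 p.1))// /Ex.
rewrite (reindex_esum [set: Y * X] _ (fun p => (p.2, p.1))).
  by apply: eq_esum => -[y x] _; rewrite /prod_mass /= mulrC.
split=> //= [[y x] [y' x'] _ _ [-> ->]//|[x y] _].
by exists (y, x).
Qed.

Lemma Ex_diag (X : choiceType) (f : X -> R) (phi : X * X -> \bar R) :
  is_probability f -> (forall p, 0 <= phi p) ->
  Ex (diag_mass f) phi = Ex f (fun x => phi (x, x)).
Proof.
move=> pf p0; rewrite /Ex.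
transitivity (\esum_(p in [set (x, x) | x in [set: X]]) ((f p.1)%:E * phi p)).
  rewrite [RHS]esum_mkcond; apply: eq_esum => -[x y] _.
  rewrite /diag_mass /=; case: eqP => [->|ne].
    by rewrite ifT// inE; exists y.
  by rewrite ifF ?mul0e//; apply: memNset => -[z _ [zx zy]]; apply: ne; rewrite -zx -zy.
by rewrite esum_image// => x y _ _ [].
Qed.

Section Convolution.
Variable G : groupType.
Implicit Types (f g : G -> R) (phi : G -> \bar R).

(** Summing over z and then over the pairs of product z is summing over all
    pairs. *)
Lemma Ex_conv f g phi : is_probability f -> is_probability g ->
  (forall x, 0 <= phi x) ->
  Ex (convolution f g) phi = Ex f (fun x => Ex g (fun y => phi (x * y)%g)).
Proof.
move=> pf pg p0; rewrite -(@Ex_prod _ _ f g (fun p => phi (p.1 * p.2)%g))//.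
have pp := prod_mass_prob pf pg.
pose D z := [set p : G * G | (p.1 * p.2)%g = z].
transitivity (\esum_(z in [set: G]) \esum_(p in D z)
    (phi (p.1 * p.2)%g * (prod_mass f g p)%:E)).
  apply: eq_esum => z _; rewrite /convolution fineK; last exact: (mass_of_fin pp).
  rewrite muleC -esumZl//; last by move=> p _; rewrite lee_fin prob_ge0.
  by apply: eq_esum => p /= ->.
rewrite (@esum_esum _ _ _ [set: G] D (fun _ p => phi (p.1 * p.2)%g * _)); last first.
  by move=> z p _ _; rewrite mule_ge0 ?lee_fin ?prob_ge0.
rewrite (reindex_esum [set: G * G] _ (fun p => ((p.1 * p.2)%g, p))).
  by apply: eq_esum => p _; rewrite muleC.
split=> [p _|p q _ _ []//|[z p] [_ /= <-]]; first by split.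
by exists p.
Qed.

Lemma convolution_ge0 f g z : is_probability f -> is_probability g ->
  (0 <= convolution f g z)%R.
Proof.
move=> pf pg; apply/fine_ge0/esum_ge0 => p _.
by rewrite lee_fin; apply: (prod_mass_prob pf pg).1.
Qed.

Lemma convolution_prob f g : is_probability f -> is_probability g ->
  is_probability (convolution f g).
Proof.
move=> pf pg; split; first by move=> z; apply: convolution_ge0.
transitivity (Ex (convolution f g) (fun=> 1)).
  by apply: eq_esum => x _; rewrite mule1.
by rewrite Ex_conv// !Ex_cst.
Qed.

Lemma Ex_dirac (x0 : G) phi : (forall x, 0 <= phi x) ->
  Ex (fun x => (x == x0)%:R) phi = phi x0.
Proof.
move=> p0; rewrite /Ex -[RHS]mul1e -(esum_set1 (a := fun x => 1 * phi x)).
  rewrite [RHS]esum_mkcond; apply: eq_esum => x _.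
  case: eqP => [->|ne]; first by rewrite ifT// inE.
  by rewrite ifF ?mul0e//; apply: memNset.
by rewrite mul1e.
Qed.

Lemma convolution_power_prob f n : is_probability f ->
  is_probability (convolution_power f n).
Proof.
move=> pf; elim: n => [|n IHn]; last exact: convolution_prob.
split=> [x|/=]; first exact: ler0n.
transitivity (Ex (fun x : G => (x == 1%g)%:R) (fun=> 1)).
  by apply: eq_esum => x _; rewrite mule1.
by rewrite Ex_dirac.
Qed.

Lemma Ex_power0 f phi : (forall x, 0 <= phi x) ->
  Ex (convolution_power f 0) phi = phi 1%g.
Proof. by move=> p0; rewrite Ex_dirac. Qed.

Lemma Ex_powerSr f n phi : is_probability f -> (forall x, 0 <= phi x) ->
  Ex (convolution_power f n.+1) phi =
  Ex (convolution_power f n) (fun w => Ex f (fun x => phi (w * x)%g)).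
Proof. by move=> pf p0; rewrite Ex_conv//; apply: convolution_power_prob. Qed.

Lemma Ex_powerD f m n phi : is_probability f -> (forall x, 0 <= phi x) ->
  Ex (convolution_power f (m + n)) phi =
  Ex (convolution_power f m) (fun x => Ex (convolution_power f n) (fun y => phi (x * y)%g)).
Proof.
move=> pf; elim: n phi => [|n IHn] phi p0.
  rewrite addn0; apply: eq_Ex; first exact: convolution_power_prob.
  by move=> x _; rewrite Ex_power0// mulg1.
rewrite addnS Ex_powerSr// IHn; last by move=> x; apply: Ex_ge0.
apply: eq_Ex; first exact: convolution_power_prob.
move=> x _; rewrite Ex_powerSr//.
have pn := convolution_power_prob n pf; apply: eq_Ex => // y _.
by apply: eq_Ex => // z _; rewrite mulgA.
Qed.

Lemma Ex_power1 f phi : is_probability f -> (forall x, 0 <= phi x) ->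
  Ex (convolution_power f 1) phi = Ex f phi.
Proof.
move=> pf p0; rewrite Ex_powerSr// Ex_power0//; last by move=> x; apply: Ex_ge0.
by apply: eq_Ex => // x _; rewrite mul1g.
Qed.

Lemma Ex_powerSl f n phi : is_probability f -> (forall x, 0 <= phi x) ->
  Ex (convolution_power f n.+1) phi =
  Ex f (fun x => Ex (convolution_power f n) (fun w => phi (x * w)%g)).
Proof.
move=> pf p0; rewrite -add1n Ex_powerD// Ex_power1// => x.
by apply: Ex_ge0 => //; apply: convolution_power_prob.
Qed.

Lemma convolution_power_mul f k m : is_probability f ->
  convolution_power f (k * m) = convolution_power (convolution_power f k) m.
Proof.
move=> pf; have pk := convolution_power_prob k pf.
have pkm := convolution_power_prob (k * m) pf.
apply: Ex_mass_ext => //; first exact: convolution_power_prob.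
elim: m {pkm} => [|m IHm] phi p0; first by rewrite muln0.
rewrite mulnSr Ex_powerD// IHm ?Ex_powerSr// => x.
by apply: Ex_ge0.
Qed.

End Convolution.

Lemma convolution_power_prod (G G' : groupType) (f : G -> R) (g : G' -> R) n :
  is_probability f -> is_probability g ->
  convolution_power (prod_mass f g) n =
  prod_mass (convolution_power f n) (convolution_power g n).
Proof.
move=> pf pg; have pfg := prod_mass_prob pf pg.
apply: Ex_mass_ext; first exact: convolution_power_prob.
  by apply: prod_mass_prob; apply: convolution_power_prob.
elim: n => [|n IHn] phi p0.
  rewrite Ex_power0// Ex_prod//; try exact: convolution_power_prob.
  rewrite Ex_power0 ?Ex_power0// => x.
  by apply: Ex_ge0 => //; apply: convolution_power_prob.
have [pfn pgn] := (convolution_power_prob n pf, convolution_power_prob n pg).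
have pgn1 := convolution_power_prob n.+1 pg.
rewrite Ex_powerSr// IHn; last by move=> x; apply: Ex_ge0.
rewrite Ex_prod//; last by move=> x; apply: Ex_ge0.
rewrite Ex_prod//; last exact: convolution_power_prob.
rewrite Ex_powerSr//; last by move=> x; apply: Ex_ge0.
apply: eq_Ex => // x _.
transitivity (Ex (convolution_power g n)
    (fun y => Ex f (fun a => Ex g (fun b => phi ((x * a)%g, (y * b)%g))))).
  by apply: eq_Ex => // y _; rewrite Ex_prod.
rewrite Ex_swap//; last by move=> y a; apply: Ex_ge0.
by apply: eq_Ex => // a _; rewrite Ex_powerSr.
Qed.

End Expectation.

(** * Paths and the weak law of large numbers *)

Section Paths.
Variable R : realType.
Local Open Scope ereal_scope.

Definition ind (b : bool) : \bar R := (b%:R : R)%:E.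

Lemma ind_ge0 b : 0 <= ind b. Proof. by rewrite lee_fin. Qed.

Lemma le_ind (b : bool) (x : \bar R) : 0 <= x -> (b -> 1 <= x) -> ind b <= x.
Proof. by case: b => //= x0; apply. Qed.

Section PathExpectation.
Variables (X : choiceType) (nu : X -> R).
Hypothesis pnu : is_probability nu.
Implicit Types (phi psi : seq X -> \bar R) (l : seq X).

(** Iterated sums over the steps play the role of the product measure on paths
    of length m. *)
Fixpoint Epath (m : nat) phi : \bar R :=
  if m is m'.+1 then Ex nu (fun y => Epath m' (fun l => phi (y :: l))) else phi [::].

Lemma Epath_ge0 m phi : (forall l, 0 <= phi l) -> 0 <= Epath m phi.
Proof.
elim: m phi => [|m IHm] phi p0 /=; first exact: p0.
by apply: Ex_ge0 => // y; apply: IHm.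
Qed.

Lemma le_Epath m phi psi :
  (forall l, size l = m -> (forall y, y \in l -> (0 < nu y)%R) -> phi l <= psi l) ->
  Epath m phi <= Epath m psi.
Proof.
elim: m phi psi => [|m IHm] phi psi le /=; first exact: le.
apply: le_Ex => // y y0; apply: IHm => l sl l0; apply: le => [/=|z].
  by rewrite sl.
by rewrite inE => /predU1P[->//|/l0].
Qed.

Lemma EpathD m phi psi : (forall l, 0 <= phi l) -> (forall l, 0 <= psi l) ->
  Epath m (fun l => phi l + psi l) = Epath m phi + Epath m psi.
Proof.
elim: m phi psi => [//|m IHm] phi psi p0 q0 /=.
rewrite -ExD//; try by move=> y; apply: Epath_ge0.
by apply: eq_Ex => // y _; apply: IHm.
Qed.

Lemma EpathZ m (c : \bar R) phi : 0 <= c -> (forall l, 0 <= phi l) ->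
  Epath m (fun l => c * phi l) = c * Epath m phi.
Proof.
elim: m phi => [//|m IHm] phi c0 p0 /=.
rewrite -ExZ//; last by move=> y; apply: Epath_ge0.
by apply: eq_Ex => // y _; apply: IHm.
Qed.

Lemma Epath_cst m (c : \bar R) : 0 <= c -> Epath m (fun=> c) = c.
Proof.
move=> c0; elim: m => [//|m IHm] /=; rewrite -[RHS](Ex_cst pnu c0).
by apply: eq_Ex => // y _.
Qed.

Lemma Epath_sum_le m (f : X -> R) (r : R) : (forall x, 0 <= f x)%R ->
  Ex nu (fun x => (f x)%:E) <= r%:E ->
  Epath m (fun l => (\sum_(y <- l) f y)%:E) <= (m%:R * r)%:E.
Proof.
move=> f0 fr; have s0 l : (0 <= \sum_(y <- l) f y)%R by apply: sumr_ge0.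
elim: m => [|m IHm] /=; first by rewrite big_nil mul0r.
apply: (@le_trans _ _ (Ex nu (fun y => (f y)%:E) + (m%:R * r)%:E)); last first.
  have -> : (m.+1%:R * r)%:E = r%:E + (m%:R * r)%:E.
    by rewrite -EFinD -natr1 mulrDl mul1r addrC.
  exact: leeD2r.
have r0 : 0 <= (m%:R * r)%:E.
  by apply: le_trans IHm; apply: Epath_ge0.
rewrite -[X in _ + X](Ex_cst pnu r0) -ExD//.
apply: le_Ex => // y _.
rewrite (_ : (fun l => _) = (fun l => (f y)%:E + (\sum_(z <- l) f z)%:E)).
  have fy0 : 0 <= (f y)%:E by rewrite lee_fin.
  have se0 l : 0 <= (\sum_(z <- l) f z)%:E by rewrite lee_fin.
  by rewrite EpathD// Epath_cst//; apply: leeD2l.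
by apply/funext => l; rewrite big_cons EFinD.
Qed.

Lemma Epath_prod_le m (g : X -> R) (r : R) : (forall x, 0 <= g x)%R ->
  Ex nu (fun x => (g x)%:E) <= r%:E ->
  Epath m (fun l => (\prod_(y <- l) g y)%:E) <= (r ^+ m)%:E.
Proof.
move=> g0 gr; have s0 l : (0 <= \prod_(y <- l) g y)%R by apply: prodr_ge0.
elim: m => [|m IHm] /=; first by rewrite big_nil expr0.
have r0 : 0 <= (r ^+ m)%:E.
  by apply: le_trans IHm; apply: Epath_ge0.
apply: (@le_trans _ _ ((r ^+ m)%:E * Ex nu (fun y => (g y)%:E))); last first.
  by rewrite exprSr EFinM; apply: lee_wpmul2l.
rewrite -ExZ//; apply: le_Ex => // y _.
rewrite (_ : (fun l => _) = (fun l => (g y)%:E * (\prod_(z <- l) g z)%:E)).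
  have gy0 : 0 <= (g y)%:E by rewrite lee_fin.
  have se0 l : 0 <= (\prod_(z <- l) g z)%:E by rewrite lee_fin.
  by rewrite EpathZ// muleC; apply: lee_wpmul2r.
by apply/funext => l; rewrite big_cons EFinM.
Qed.

End PathExpectation.

Lemma Ex_power_path (G : groupType) (nu : G -> R) m (phi : G -> \bar R) :
  is_probability nu -> (forall x, 0 <= phi x) ->
  Ex (convolution_power nu m) phi = Epath nu m (fun l => phi (\prod_(y <- l) y)%g).
Proof.
move=> pnu; elim: m phi => [|m IHm] phi p0 /=.
  by rewrite Ex_dirac// big_nil.
rewrite -/(convolution_power nu m.+1) Ex_powerSl//.
apply: eq_Ex => // y _; rewrite IHm//; congr Epath.
by apply/funext => l; rewrite big_cons.
Qed.

Section LargeDeviations.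
Variables (X : choiceType) (nu : X -> R).
Hypothesis pnu : is_probability nu.
Implicit Types (f g : X -> R).

(** Because exp (- x) >= 1 - x and (1 - x) (1 + x + 2 x^2) >= 1 on this range. *)
Lemma expR_le_quad (x : R) : (0 <= x <= 2^-1)%R -> (expR x <= 1 + x + 2 * x ^+ 2)%R.
Proof.
move=> /andP[x0 x2]; have h : (1 - x <= expR (- x))%R by exact: expR_ge1Dx.
have e0 := expR_gt0 x; have : (expR x * (1 - x) <= 1)%R.
  by rewrite -[leRHS](expRxMexpNx_1 x) ler_pM2l.
nra.
Qed.

(** Chernoff's bound: for small lam > 0 the exponential moment of lam (g - c) is
    below 1, because its linear term lam (r - c) is negative and g is bounded. *)
Lemma bounded_upper_tail g (T r c : R) : (forall x, 0 <= g x <= T)%R ->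
  Ex nu (fun x => (g x)%:E) <= r%:E -> (r < c)%R ->
  forall eta : R, (0 < eta)%R ->
  \forall m \near \oo,
    Epath nu m (fun l => ind (m%:R * c < \sum_(y <- l) g y)%R) <= eta%:E.
Proof.
move=> gT gr rc eta eta0.
have g0 x : (0 <= g x)%R by case/andP: (gT x).
have r0 : (0 <= r)%R by rewrite -lee_fin; apply: le_trans gr; apply: Ex_ge0.
pose T' : R := (`|T| + 1)%R; have T'0 : (0 < T')%R by rewrite /T' ltr_wpDl.
have gT' x : (g x <= T')%R.
  have /andP[_ gx] := gT x; apply: le_trans gx _.
  by apply: le_trans (ler_norm _) _; rewrite lerDl.
(* The first bound on lam keeps lam g below 1/2; the second one makes the
   quadratic term at most half of the linear gain. *)
pose lam : R := Num.min (2 * T')^-1%R ((c - r) / (4 * T' ^+ 2))%R.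
have lam0 : (0 < lam)%R.
  by rewrite lt_min invr_gt0 mulr_gt0//= divr_gt0 ?subr_gt0// mulr_gt0// exprn_gt0.
have lam1 : (lam * T' <= 2^-1)%R.
  have : (lam <= (2 * T')^-1)%R by rewrite ge_min lexx.
  by rewrite invfM -ler_pdivlMr.
have lam2 : (2 * (lam * T') ^+ 2 <= lam * ((c - r) / 2))%R.
  have : (lam <= (c - r) / (4 * T' ^+ 2))%R by rewrite ge_min lexx orbT.
  rewrite ler_pdivlMr; last by rewrite mulr_gt0// exprn_gt0.
  move: lam0; move: (lam) => u u0 h.
  have : (u * (u * (4 * T' ^+ 2)) <= u * (c - r))%R by rewrite ler_pM2l.
  rewrite exprMn expr2; move: (T' ^+ 2)%R => v; nra.
pose q : R := expR (- (lam * ((c - r) / 2)))%R.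
have q0 : (0 < q)%R by exact: expR_gt0.
have q1 : (q < 1)%R.
  by rewrite expR_lt1 oppr_lt0 mulr_gt0// divr_gt0// subr_gt0.
pose e x : R := expR (lam * g x - lam * c)%R.
have Ee : Ex nu (fun x => (e x)%:E) <= q%:E.
  have b x : (e x <= expR (- (lam * c)) * (1 + lam * g x + 2 * (lam * T') ^+ 2))%R.
    rewrite /e expRD [leLHS]mulrC ler_pM2l ?expR_gt0//.
    have gx : (0 <= lam * g x <= lam * T')%R.
      by rewrite ler_pM2l // mulr_ge0 ?gT' // (ltW lam0).
    apply: le_trans (expR_le_quad _) _.
      by case/andP: gx => -> /le_trans; apply.
    rewrite lerD2l ler_pM2l// ler_pXn2r// ?nnegrE.
    + by case/andP: gx.
    + by case/andP: gx.
    + by rewrite mulr_ge0// ltW.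
  apply: (@le_trans _ _ (Ex nu (fun x => (expR (- (lam * c)))%:E *
      ((1 + 2 * (lam * T') ^+ 2)%:E + lam%:E * (g x)%:E)))).
    apply: le_Ex => // x _.
    rewrite (_ : _ * _ =
      (expR (- (lam * c)) * (1 + 2 * (lam * T') ^+ 2 + lam * g x))%R%:E)// lee_fin.
    by apply: le_trans (b x) _; rewrite [X in (_ <= _ * X)%R]addrAC.
  have k0 : (0 <= 1 + 2 * (lam * T') ^+ 2)%R by rewrite addr_ge0// mulr_ge0// sqr_ge0.
  have lg0 x : 0 <= lam%:E * (g x)%:E.
    by rewrite -EFinM lee_fin mulr_ge0 // ltW.
  rewrite ExZ ?lee_fin ?expR_ge0//; last by move=> x; rewrite adde_ge0// lee_fin.
  rewrite ExD// Ex_cst// ExZ ?lee_fin//; last exact: ltW.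
  apply: (@le_trans _ _ ((expR (- (lam * c)))%:E *
      ((1 + 2 * (lam * T') ^+ 2)%:E + lam%:E * r%:E))).
    apply: lee_wpmul2l; first by rewrite lee_fin expR_ge0.
    by apply: leeD2l; apply: lee_wpmul2l; rewrite ?lee_fin// ltW.
  rewrite (_ : _ * _ =
    (expR (- (lam * c)) * (1 + 2 * (lam * T') ^+ 2 + lam * r))%R%:E)// lee_fin.
  apply: (@le_trans _ _ (expR (- (lam * c)) * expR (2 * (lam * T') ^+ 2 + lam * r))%R).
    by rewrite ler_pM2l ?expR_gt0// -addrA expR_ge1Dx.
  rewrite -expRD ler_expR; move: lam2; lra.
have [M _ qM] : \forall m \near \oo, (q ^+ m <= eta)%R.
  have /cvgrPdist_le /(_ eta eta0) : (GRing.exp q : nat -> R) @ \oo --> (0 : R)%R.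
    by apply: cvg_expr; rewrite ger0_norm// ltW.
  apply: filterS => m; rewrite sub0r normrN ger0_norm//.
  by rewrite exprn_ge0// ltW.
exists M => // m /qM qm; apply: (@le_trans _ _ (q ^+ m)%:E); last by rewrite lee_fin.
apply: le_trans (Epath_prod_le pnu m _ Ee); last by move=> x; exact: expR_ge0.
apply: le_Epath => // l sl _.
have -> : (\prod_(y <- l) e y)%R = expR (lam * (\sum_(y <- l) g y - m%:R * c)).
  rewrite -sl; elim: l {sl} => [|y l IHl].
    by rewrite !big_nil mul0r subrr mulr0 expR0.
  rewrite !big_cons IHl /e -expRD; congr expR.
  by rewrite /= -natr1; lra.
apply: le_ind; first by rewrite lee_fin expR_ge0.
move=> lt; rewrite lee_fin -[leLHS]expR0 ler_expR; apply: mulr_ge0; first exact: ltW.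
by rewrite subr_ge0 ltW.
Qed.

(** A finite partial sum nearly exhausts the expectation of f, and truncating at
    a level above the values of f on its index set does not affect it. *)
Lemma truncation f (r : R) : (forall x, 0 <= f x)%R ->
  Ex nu (fun x => (f x)%:E) <= r%:E -> forall eps : R, (0 < eps)%R ->
  exists2 T : R, (0 <= T)%R &
    Ex nu (fun x => (f x - Num.min (f x) T)%:E) <= eps%:E.
Proof.
move=> f0 fr eps eps0.
have mf0 x : 0 <= (nu x)%:E * (f x)%:E.
  by rewrite -EFinM lee_fin mulr_ge0// prob_ge0.
have E0 : 0 <= Ex nu (fun x => (f x)%:E) by apply: Ex_ge0.
have Efin : Ex nu (fun x => (f x)%:E) \is a fin_num.
  by rewrite ge0_fin_numE// (le_lt_trans fr)// ltry.
have [Y [finY _] hY] : exists2 Y : set X, fsets setT Y &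
    Ex nu (fun x => (f x)%:E) - eps%:E < \sum_(x \in Y) (nu x)%:E * (f x)%:E.
  have := ub_ereal_sup_adherent eps0 Efin.
  by move=> [_ [Y fY <-] hY]; exists Y.
pose T := (\sum_(x <- fset_set Y) f x)%R.
have T0 : (0 <= T)%R by apply: sumr_ge0.
exists T => //.
have minE0 x : 0 <= (Num.min (f x) T)%:E by rewrite lee_fin le_min f0.
have dE0 x : 0 <= (f x - Num.min (f x) T)%:E by rewrite lee_fin subr_ge0 ge_min lexx.
have split : Ex nu (fun x => (f x)%:E) = Ex nu (fun x => (Num.min (f x) T)%:E) +
    Ex nu (fun x => (f x - Num.min (f x) T)%:E).
  by rewrite -ExD//; apply: eq_Ex => // x _; rewrite -EFinD addrC subrK.
have big : \sum_(x \in Y) (nu x)%:E * (f x)%:E <= Ex nu (fun x => (Num.min (f x) T)%:E).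
  apply: esum_ge; exists Y => //.
  rewrite !fsbig_finite//= !big_seq; apply: lee_sum => x xY.
  rewrite (_ : Num.min (f x) T = f x)//; apply/min_idPl.
  by rewrite /T (big_fsetD1 x)//= lerDl sumr_ge0.
have Mfin : Ex nu (fun x => (Num.min (f x) T)%:E) \is a fin_num.
  rewrite ge0_fin_numE; last exact: Ex_ge0.
  apply: le_lt_trans (le_lt_trans fr (ltry _)).
  by apply: le_Ex => // x _; rewrite lee_fin ge_min lexx.
have := lt_le_trans hY big; rewrite lteBlDr//.
by move=> /ltW; rewrite split leeD2lE.
Qed.

(** The upper half of the weak law of large numbers. The truncated variables
    obey Chernoff's bound, and the excess over the truncation has a small mean,
    to which Markov's inequality applies. *)
Lemma upper_tail f (r c : R) : (forall x, 0 <= f x)%R ->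
  Ex nu (fun x => (f x)%:E) <= r%:E -> (r < c)%R ->
  forall eta : R, (0 < eta)%R ->
  \forall m \near \oo,
    Epath nu m (fun l => ind (m%:R * c < \sum_(y <- l) f y)%R) <= eta%:E.
Proof.
move=> f0 fr rc eta eta0; pose eps := ((c - r) / 2)%R.
have eps0 : (0 < eps)%R by rewrite divr_gt0// subr_gt0.
have [T T0 hT] := truncation f0 fr (mulr_gt0 eps0 (divr_gt0 eta0 (ltr0n R 2))).
pose g x := Num.min (f x) T.
have g0 x : (0 <= g x)%R by rewrite le_min f0.
have d0 x : (0 <= f x - g x)%R by rewrite subr_ge0 ge_min lexx.
have gT x : (0 <= g x <= T)%R by rewrite g0 ge_min lexx orbT.
have gr : Ex nu (fun x => (g x)%:E) <= r%:E.
  by apply: le_trans fr; apply: le_Ex => // x _; rewrite lee_fin ge_min lexx.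
have rc' : (r < c - eps)%R by rewrite /eps; lra.
have tail := bounded_upper_tail gT gr rc' (divr_gt0 eta0 (ltr0n R 2)).
near=> m.
have m0 : (0 < m%:R :> R)%R by rewrite ltr0n; near: m; exists 1%N.
apply: (@le_trans _ _ (Epath nu m (fun l => ind (m%:R * (c - eps) < \sum_(y <- l) g y)%R)
   + Epath nu m (fun l => ((m%:R * eps)^-1)%R%:E * (\sum_(y <- l) (f y - g y))%:E))).
  have me0 : (0 < m%:R * eps)%R by rewrite mulr_gt0.
  have s0 l : (0 <= \sum_(y <- l) (f y - g y))%R by apply: sumr_ge0.
  have t0 l : 0 <= ((m%:R * eps)^-1)%R%:E * (\sum_(y <- l) (f y - g y))%:E.
    by rewrite -EFinM lee_fin mulr_ge0// invr_ge0 ltW.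
  rewrite -EpathD//; last by move=> l; exact: ind_ge0.
  apply: le_Epath => // l _ _; apply: le_ind.
    by rewrite adde_ge0// ind_ge0.
  move=> lt; have [le|gt] := leP (\sum_(y <- l) g y)%R (m%:R * (c - eps))%R; last first.
    by rewrite /ind /= leeDl.
  rewrite /ind /= add0e -EFinM lee_fin mulrC ler_pdivlMr// mul1r sumrB.
  by move: le lt; rewrite mulrBr; lra.
have -> : eta%:E = (eta / 2)%:E + (eta / 2)%:E by rewrite -EFinD -splitr.
apply: leeD; first by near: m.
have s0 l : 0 <= (\sum_(y <- l) (f y - g y))%:E by rewrite lee_fin sumr_ge0.
rewrite EpathZ//; last by rewrite lee_fin invr_ge0 mulr_ge0// ltW.
apply: (@le_trans _ _ (((m%:R * eps)^-1)%R%:E * (m%:R * (eps * (eta / 2)))%:E)).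
  apply: lee_wpmul2l; first by rewrite lee_fin invr_ge0 mulr_ge0// ltW.
  exact: Epath_sum_le.
by rewrite -EFinM lee_fin (mulrA m%:R) mulKf// mulf_neq0// gt_eqF.
Unshelve. all: by end_near. Qed.

(** Truncation only lowers f, and a lower tail of min (f, T) is an upper tail
    of the bounded function T - min (f, T). *)
Lemma lower_tail f (r c : R) : (forall x, 0 <= f x)%R ->
  Ex nu (fun x => (f x)%:E) = r%:E -> (c < r)%R ->
  forall eta : R, (0 < eta)%R ->
  \forall m \near \oo,
    Epath nu m (fun l => ind (\sum_(y <- l) f y < m%:R * c)%R) <= eta%:E.
Proof.
move=> f0 fr cr eta eta0.
have fr' : Ex nu (fun x => (f x)%:E) <= r%:E by rewrite fr.
have eps0 : (0 < (r - c) / 2)%R by rewrite divr_gt0// subr_gt0.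
have [T T0 hT] := truncation f0 fr' eps0.
pose g x := (T - Num.min (f x) T)%R.
have gT x : (0 <= g x <= T)%R.
  by rewrite /g subr_ge0 ge_min lexx orbT/= lerBlDr lerDl le_min f0.
have g0 x : 0 <= (g x)%:E by rewrite lee_fin; case/andP: (gT x).
have d0 x : 0 <= (f x - Num.min (f x) T)%:E by rewrite lee_fin subr_ge0 ge_min lexx.
have Eg : Ex nu (fun x => (g x)%:E) <= (T - r + (r - c) / 2)%:E.
  have : Ex nu (fun x => (g x)%:E) + r%:E =
      T%:E + Ex nu (fun x => (f x - Num.min (f x) T)%:E).
    rewrite -fr -ExD// -[X in X + _](Ex_cst pnu (c := T%:E)) ?lee_fin// -ExD//.
    by apply: eq_Ex => // x _; rewrite -!EFinD /g; congr EFin; lra.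
  move=> e; rewrite -(@leeD2rE _ r%:E)// e -EFinD.
  by rewrite (_ : (_ - r + _ + r)%R = (T + (r - c) / 2)%R) ?EFinD ?leeD2l//; lra.
have rc' : (T - r + (r - c) / 2 < T - c)%R by lra.
have := bounded_upper_tail gT Eg rc' eta0; apply: filterS => m; apply: le_trans.
apply: le_Epath => // l sl _; apply: le_ind; first exact: ind_ge0.
move=> lt; suff -> : (m%:R * (T - c) < \sum_(y <- l) g y)%R by [].
have le : (\sum_(y <- l) Num.min (f y) T <= \sum_(y <- l) f y)%R.
  by apply: ler_sum => y _; rewrite ge_min lexx.
have e : (\sum_(y <- l) T = m%:R * T)%R.
  by rewrite big_const_seq count_predT iter_addr_0 sl mulr_natl.
rewrite /g sumrB e; move: le lt; lra.
Qed.

End LargeDeviations.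
End Paths.

(** * Entropy and the size of typical sets *)

Section Entropy.
Variable R : realType.
Local Open Scope ereal_scope.

Definition entropy (X : choiceType) (nu : X -> R) : \bar R :=
  Ex nu (fun x => (- ln (nu x))%:E).

Definition set_size (X : choiceType) (A : set X) : \bar R := \esum_(x in A) (1 : \bar R).

Lemma Nln_ge0 (X : choiceType) (nu : X -> R) x : is_probability nu ->
  (0 <= - ln (nu x))%R.
Proof. by move=> pnu; rewrite oppr_ge0 ln_le0// prob_le1. Qed.

Lemma entropy_ge0 (X : choiceType) (nu : X -> R) : is_probability nu ->
  0 <= entropy nu.
Proof. by move=> pnu; apply: Ex_ge0 => // x; rewrite lee_fin Nln_ge0. Qed.

Lemma convolution_ge (G : groupType) (f g : G -> R) x y :
  is_probability f -> is_probability g ->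
  (f x * g y <= convolution f g (x * y)%g)%R.
Proof.
move=> pf pg; rewrite -lee_fin /convolution fineK; last first.
  exact: (mass_of_fin (prod_mass_prob pf pg)).
apply: esum_ge; exists [set (x, y)].
  by split=> [|_ ->]; [exact: finite_set1|].
by rewrite fsbig_set1.
Qed.

Lemma convolution_powerSl (G : groupType) (f : G -> R) n : is_probability f ->
  convolution_power f n.+1 = convolution f (convolution_power f n).
Proof.
move=> pf; have pn := convolution_power_prob n pf.
apply: Ex_mass_ext; [exact: (convolution_power_prob n.+1)|exact: convolution_prob|].
by move=> phi p0; rewrite Ex_powerSl// Ex_conv.
Qed.

(** A single path contributes to the mass of its end point. *)
Lemma power_ge_prod (G : groupType) (q : G -> R) (l : seq G) : is_probability q ->
  (\prod_(y <- l) q y <= convolution_power q (size l) (\prod_(y <- l) y)%g)%R.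
Proof.
move=> pq; elim: l => [|y l IHl]; first by rewrite !big_nil /= eqxx.
rewrite !big_cons convolution_powerSl//.
apply: le_trans (convolution_ge y _ pq (convolution_power_prob _ pq)).
by apply: ler_wpM2l => //; exact: prob_ge0.
Qed.

Lemma prod_expR_sum (X : choiceType) (q : X -> R) (l : seq X) :
  (forall y, y \in l -> (0 < q y)%R) ->
  (\prod_(y <- l) q y)%R = expR (- \sum_(y <- l) - ln (q y))%R.
Proof.
elim: l => [|y l IHl] q0; first by rewrite !big_nil oppr0 expR0.
rewrite !big_cons IHl; last by move=> z zl; apply: q0; rewrite inE zl orbT.
by rewrite opprD opprK expRD lnK// posrE q0// mem_head.
Qed.

Lemma power_ge_expR (G : groupType) (q : G -> R) (l : seq G) : is_probability q ->
  (forall y, y \in l -> (0 < q y)%R) ->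
  (expR (- \sum_(y <- l) - ln (q y)) <=
     convolution_power q (size l) (\prod_(y <- l) y)%g)%R.
Proof. by move=> pq q0; rewrite -prod_expR_sum// power_ge_prod. Qed.

(** A path of m steps forces its end point to have q_m-mass at least the
    exponential of the sum of the ln q over its steps, and by the weak law that
    sum is above - m c with high probability. At most exp (m c) points have
    q_m-mass exp (- m c) or more, by set_size_level. The measure q may differ from nu, so
    that a walk can be compared with an explicit reference law. *)
Lemma typical_set_upper (G : groupType) (nu q : G -> R) (r c : R) :
  is_probability nu -> is_probability q ->
  (forall x, (0 < nu x)%R -> (0 < q x)%R) ->
  Ex nu (fun x => (- ln (q x))%:E) <= r%:E -> (r < c)%R ->
  forall eta : R, (0 < eta)%R -> \forall m \near \oo,
    mass_of (convolution_power nu m)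
      [set z | (convolution_power q m z < expR (- (m%:R * c)))%R] <= eta%:E.
Proof.
move=> pn pq nq Er rc eta eta0.
have := upper_tail pn (fun x => Nln_ge0 x pq) Er rc eta0.
apply: filterS => m; apply: le_trans.
rewrite mass_of_Ex Ex_power_path//.
apply: le_Epath => // l sl l0; rewrite indicE /ind lee_fin.
case: (boolP (_ \in _)) => //; rewrite inE /= => lt.
suff -> : (m%:R * c < \sum_(y <- l) - ln (q y))%R by [].
rewrite -ltrN2 -ltr_expR; apply: le_lt_trans lt; rewrite -sl.
by apply: power_ge_expR => // y /l0/nq.
Qed.

Lemma set_size_level (X : choiceType) (nu : X -> R) (a : R) : is_probability nu ->
  (0 < a)%R -> set_size [set z | (a <= nu z)%R] <= (a^-1)%R%:E.
Proof.
move=> pn a0; rewrite -(@lee_pmul2l _ a%:E)// -EFinM mulfV ?gt_eqF//.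
rewrite /set_size -esumZl//; last by rewrite lee_fin ltW.
apply: le_trans (mass_of_le1 pn [set z | (a <= nu z)%R]).
by apply: le_esum => z /= az; rewrite mule1 lee_fin.
Qed.

Lemma mass_of_le_set_size (X : choiceType) (nu : X -> R) (a : R) (A : set X) :
  is_probability nu -> (0 <= a)%R ->
  mass_of nu A <= mass_of nu [set z | (a < nu z)%R] + a%:E * set_size A.
Proof.
move=> pn a0; rewrite /set_size -esumZl ?lee_fin//.
rewrite /mass_of (esumID [set z | (a < nu z)%R]) ?lee_fin//; last first.
  by move=> i _; rewrite lee_fin prob_ge0.
apply: leeD; first by apply: mass_of_le => // z [].
rewrite [leRHS](esumID [set z | (a < nu z)%R]); last first.
  by move=> i _; rewrite mule1 lee_fin.
rewrite -[leLHS]add0e; apply: leeD.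
  by apply: esum_ge0 => z _; rewrite mule1 lee_fin.
by apply: le_esum => z [_ /negP]; rewrite -leNgt mule1 lee_fin.
Qed.

Lemma set_size_translate (G : groupType) (A : set G) y :
  set_size [set x | A (x * y)%g] = set_size A.
Proof.
rewrite /set_size (reindex_esum [set x | A (x * y)%g] A (fun x => (x * y)%g))//.
split=> [x //|x x' _ _ /mulIg//|z Az].
by exists (z * y^-1)%g; rewrite /= mulgVK.
Qed.

(** Conditioning on the last b steps replaces A by translates of A. *)
Lemma mass_power_translate (G : groupType) (nu : G -> R) a b (e : R) (A : set G) :
  is_probability nu -> (0 <= e)%R ->
  (forall y, mass_of (convolution_power nu a) [set x | A (x * y)%g] <= e%:E) ->
  mass_of (convolution_power nu (a + b)) A <= e%:E.
Proof.
move=> pn e0 h; have pa n := convolution_power_prob n pn.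
rewrite mass_of_Ex// Ex_powerD// Ex_swap//.
rewrite -[leRHS](Ex_cst (pa b)) ?lee_fin//; apply: le_Ex => // y _.
have := h y; rewrite mass_of_Ex; apply: le_trans; exact: le_Ex.
Qed.

(** Along a path y_1, ..., y_m the deficit of - ln N_m at the end point below the
    sum of the - ln N (y_i) is nonnegative, with mean at most m (HN - h). By
    Markov's inequality it rarely exceeds m theta, and by the weak law the sum
    itself is rarely below m (c + theta). *)
Lemma block_concentration (G : groupType) (N : G -> R) (HN h theta c : R) :
  is_probability N -> entropy N = HN%:E -> (0 < theta)%R -> (0 < h)%R ->
  (forall m, (m%:R * h)%:E <= entropy (convolution_power N m)) ->
  (c + theta < HN)%R -> forall eta : R, (0 < eta)%R -> \forall m \near \oo,
    mass_of (convolution_power N m)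
      [set z | (expR (- (m%:R * c)) < convolution_power N m z)%R]
      <= ((HN - h) / theta + eta)%:E.
Proof.
move=> pN EN theta0 h0 Hm cH eta eta0.
pose f x := (- ln (N x))%R.
have f0 x : (0 <= f x)%R by exact: Nln_ge0.
have lt := lower_tail pN f0 EN cH eta0.
near=> m.
have m0 : (0 < m%:R :> R)%R by rewrite ltr0n; near: m; exists 1%N.
have pm := convolution_power_prob m pN.
pose F z := (- ln (convolution_power N m z))%R.
have F0 z : (0 <= F z)%R by exact: Nln_ge0.
have FS l : size l = m -> (forall y, y \in l -> (0 < N y)%R) ->
    (F (\prod_(y <- l) y)%g <= \sum_(y <- l) f y)%R /\
    (0 < convolution_power N m (\prod_(y <- l) y)%g)%R.
  move=> sl l0; have := power_ge_expR pN l0; rewrite sl => lb.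
  have p0 := lt_le_trans (expR_gt0 _) lb.
  by split=> //; rewrite lerNl -ler_expR lnK// posrE.
pose B l := (m%:R * theta < \sum_(y <- l) f y - F (\prod_(y <- l) y)%g)%R.
have EB : Epath N m (fun l => ind R (B l)) <= ((HN - h) / theta)%:E.
  have mt0 : (0 < m%:R * theta)%R by rewrite mulr_gt0.
  have S0 l : 0 <= (F (\prod_(y <- l) y)%g)%:E by rewrite lee_fin.
  have I0 l : 0 <= (m%:R * theta)%:E * ind R (B l).
    by rewrite mule_ge0 ?ind_ge0// lee_fin ltW.
  have le : Epath N m (fun l => (m%:R * theta)%:E * ind R (B l)) +
      Epath N m (fun l => (F (\prod_(y <- l) y)%g)%:E) <= (m%:R * HN)%:E.
    rewrite -EpathD//.
    have EN' : Ex N (fun x => (f x)%:E) <= HN%:E by rewrite -EN.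
    apply: le_trans (Epath_sum_le pN m f0 EN').
    apply: le_Epath => // l sl l0; have [le _] := FS l sl l0.
    rewrite -EFinM -EFinD lee_fin /B; case: ltP => /= [lt'|_].
      by rewrite mulr1; move: lt'; lra.
    by rewrite mulr0 add0r.
  have eF : Epath N m (fun l => (F (\prod_(y <- l) y)%g)%:E) = entropy (convolution_power N m).
    by rewrite /entropy Ex_power_path// => x; rewrite lee_fin F0.
  rewrite eF EpathZ ?lee_fin ?(ltW mt0)// in le; last by move=> l; exact: ind_ge0.
  rewrite -(@lee_pmul2l _ (m%:R * theta)%:E)//.
  have -> : (m%:R * theta)%:E * ((HN - h) / theta)%:E = (m%:R * HN)%:E - (m%:R * h)%:E.
    rewrite -EFinM -EFinB; congr EFin; rewrite -mulrBr -mulrA; congr (_ * _)%R.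
    by rewrite mulrCA mulfV ?mulr1// gt_eqF.
  rewrite leeBrDr//; apply: le_trans le; exact: leeD2l.
rewrite mass_of_Ex// Ex_power_path//.
apply: (@le_trans _ _ (Epath N m (fun l => ind R (B l)) +
    Epath N m (fun l => ind R (\sum_(y <- l) f y < m%:R * (c + theta))%R))); last first.
  by rewrite EFinD; apply: leeD => //; near: m.
rewrite -EpathD//; try by move=> l; exact: ind_ge0.
apply: le_Epath => // l sl l0; have [_ p0] := FS l sl l0.
rewrite indicE -[X in X <= _]/(ind R _); apply: le_ind.
  by rewrite adde_ge0// ind_ge0.
rewrite inE /= => big.
have Fc : (F (\prod_(y <- l) y)%g < m%:R * c)%R.
  by rewrite /F ltrNl -ltr_expR lnK// posrE.
have [le|gt] := leP (m%:R * (c + theta))%R (\sum_(y <- l) f y)%R; last first.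
  by rewrite [ind R true]/ind /= leeDr// ind_ge0.
have -> : B l by rewrite /B; move: Fc le; rewrite mulrDr; lra.
by rewrite [ind R true]/ind /= leeDl// ind_ge0.
Unshelve. all: by end_near. Qed.

End Entropy.

Section EntropyRate.
Variable R : realType.
Local Open Scope ereal_scope.

Lemma near_divn (k : nat) (P : nat -> Prop) : (0 < k)%N ->
  (\forall m \near \oo, P m) -> \forall n \near \oo, P (n %/ k)%N.
Proof.
move=> k0 [M _ MP]; exists (M * k)%N => // n /= Mn; apply: MP => /=.
by rewrite leq_divRL.
Qed.

(** A converse coding theorem. Blocks of a length k whose entropy is close to
    k h have a small deficit in block_concentration, so at times m k the mass at
    the end point is mostly below exp (- m k c') with c' between c and h, and a
    set of exp (n c) points collects little. The last n mod k steps only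
    translate the set. *)
Lemma small_sets_negligible (G : groupType) (nu : G -> R) (h c : R) :
  is_probability nu -> (0 <= c < h)%R ->
  (forall n, (n%:R * h)%:E <= entropy (convolution_power nu n)) ->
  (forall eps : R, (0 < eps)%R -> exists2 k, (0 < k)%N &
     entropy (convolution_power nu k) <= (k%:R * (h + eps))%:E) ->
  forall eta : R, (0 < eta)%R -> \forall n \near \oo, forall A : set G,
    set_size R A <= (expR (n%:R * c))%:E ->
    mass_of (convolution_power nu n) A <= eta%:E.
Proof.
move=> pn /andP[c0 ch] Hlow Hup eta eta0.
have h0 : (0 < h)%R by exact: le_lt_trans ch.
(* The range from c up to h is shared between c' - c, which absorbs the size of
   the set, and the fluctuations of block_concentration. *)
pose theta := ((h - c) / 4)%R; have theta0 : (0 < theta)%R.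
  by rewrite divr_gt0// subr_gt0.
have eps0 : (0 < theta * (eta / 4))%R by rewrite mulr_gt0// divr_gt0.
have [k k0 Hk] := Hup _ eps0.
have kR0 : (0 < k%:R :> R)%R by rewrite ltr0n.
pose N := convolution_power nu k; have pN : is_probability N by exact: convolution_power_prob.
have HNfin : entropy N \is a fin_num.
  by rewrite ge0_fin_numE ?entropy_ge0// (le_lt_trans Hk)// ltry.
pose HN := fine (entropy N); have EN : entropy N = HN%:E by rewrite fineK.
have HN1 : (k%:R * h <= HN)%R by rewrite -lee_fin -EN Hlow.
have HN2 : (HN <= k%:R * (h + theta * (eta / 4)))%R by rewrite -lee_fin -EN.
pose c' := ((c + h) / 2)%R.
have NL m : (m%:R * (k%:R * h))%:E <= entropy (convolution_power N m).
  by rewrite /N -convolution_power_mul// mulrA -natrM mulnC Hlow.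
have gap : (k%:R * c' + k%:R * theta < HN)%R.
  by apply: lt_le_trans HN1; rewrite -mulrDr ltr_pM2l// /c' /theta; lra.
have eta4 : (0 < eta / 4)%R by rewrite divr_gt0.
have conc := block_concentration pN EN (mulr_gt0 kR0 theta0) (mulr_gt0 kR0 h0) NL gap eta4.
pose q := expR (- (k%:R * (c' - c)))%R.
have q1 : (q < 1)%R.
  by rewrite expR_lt1 oppr_lt0 mulr_gt0// /c'; lra.
have d0 : (0 < eta / 2 / expR (k%:R * c))%R by rewrite !divr_gt0// expR_gt0.
have qm : \forall m \near \oo, (q ^+ m <= eta / 2 / expR (k%:R * c))%R.
  have /cvgrPdist_le /(_ _ d0) : (GRing.exp q : nat -> R) @ \oo --> (0 : R)%R.
    by apply: cvg_expr; rewrite ger0_norm ?expR_ge0.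
  by apply: filterS => m; rewrite sub0r normrN ger0_norm// exprn_ge0// expR_ge0.
have {}conc := near_divn k0 conc; have {}qm := near_divn k0 qm.
apply: filterS2 conc qm => n.
move: (divn_eq n k) (ltn_pmod n k0); rewrite mulnC.
set m := (n %/ k)%N; set r := (n %% k)%N => nE rk concm qmm A cA.
rewrite nE; apply: mass_power_translate => //; first exact: ltW.
move=> y; rewrite convolution_power_mul// -/N.
have pNm := convolution_power_prob m pN.
apply: le_trans (mass_of_le_set_size _ pNm (expR_ge0 (- (m%:R * (k%:R * c')))%R)) _.
have -> : eta%:E = (eta / 4 + eta / 4)%:E + (eta / 2)%:E.
  by rewrite -EFinD; congr EFin; lra.
apply: leeD.
  apply: le_trans concm _; rewrite lee_fin lerD2r ler_pdivrMr; last exact: (mulr_gt0 kR0 theta0).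
  by move: HN2; nra.
rewrite (set_size_translate R A y); apply: (@le_trans _ _
    ((expR (- (m%:R * (k%:R * c'))))%:E * (expR (k%:R * c + (m%:R * (k%:R * c))))%:E)).
  apply: lee_wpmul2l; first by rewrite lee_fin expR_ge0.
  apply: le_trans cA _; rewrite lee_fin ler_expR nE natrD natrM.
  have : (r%:R <= k%:R :> R)%R by rewrite ler_nat ltnW.
  by move=> rk'; have : (r%:R * c <= k%:R * c)%R by [exact: ler_wpM2r]; lra.
rewrite -EFinM lee_fin -expRD.
have -> : (- (m%:R * (k%:R * c')) + (k%:R * c + m%:R * (k%:R * c)) =
    k%:R * c + m%:R * - (k%:R * (c' - c)))%R by lra.
rewrite expRD (expRM_natl m) [leLHS]mulrC -ler_pdivlMr; first exact: qmm.
exact: expR_gt0.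
Qed.

(** The mass of x y is at least the product of the masses of x and of y. *)
Lemma entropy_powerD (G : groupType) (f : G -> R) a b : is_probability f ->
  entropy (convolution_power f (a + b)) <=
  entropy (convolution_power f a) + entropy (convolution_power f b).
Proof.
move=> pf; have pp n := convolution_power_prob n pf.
have N0 n x : 0 <= (- ln (convolution_power f n x))%:E by rewrite lee_fin Nln_ge0.
rewrite {1}/entropy Ex_powerD//.
have -> : entropy (convolution_power f a) + entropy (convolution_power f b) =
  Ex (convolution_power f a) (fun x => Ex (convolution_power f b) (fun y =>
    (- ln (convolution_power f a x))%:E + (- ln (convolution_power f b y))%:E)).
  rewrite -[X in _ + X](Ex_cst (pp a)) ?entropy_ge0// /entropy -ExD//; last first.
    by move=> x; apply: Ex_ge0.
  by apply: eq_Ex => // x _; rewrite ExD// Ex_cst.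
apply: le_Ex => // x x0; apply: le_Ex => // y y0.
rewrite -EFinD lee_fin -opprD lerN2 -lnM ?posrE//.
have le : (convolution_power f a x * convolution_power f b y <=
    convolution_power f (a + b) (x * y)%g)%R.
  have cE : convolution_power f (a + b) =
      convolution (convolution_power f a) (convolution_power f b).
    apply: Ex_mass_ext => //; first exact: convolution_prob.
    by move=> phi p0; rewrite Ex_powerD// Ex_conv.
  by rewrite cE convolution_ge.
by rewrite ler_ln// posrE ?mulr_gt0// (lt_le_trans _ le)// mulr_gt0.
Qed.

Lemma entropy_power0 (G : groupType) (f : G -> R) :
  entropy (convolution_power f 0) = 0.
Proof.
rewrite /entropy /= Ex_dirac /= ?eqxx ?ln1 ?oppr0// => x.
by rewrite lee_fin oppr_ge0 ln_le0//; case: eqP.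
Qed.

Lemma entropy_power_le (G : groupType) (f : G -> R) n (H : R) : is_probability f ->
  entropy f <= H%:E -> entropy (convolution_power f n) <= (n%:R * H)%:E.
Proof.
move=> pf fH; elim: n => [|n IHn]; first by rewrite entropy_power0 mul0r.
rewrite -addn1; apply: le_trans (entropy_powerD _ _ pf) _.
rewrite natrD mulrDl mul1r EFinD; apply: leeD => //.
have -> : convolution_power f 1 = f; last exact: fH.
apply: Ex_mass_ext => //; first exact: (convolution_power_prob 1).
by move=> phi p0; rewrite Ex_power1.
Qed.

Lemma entropy_prod (X Y : choiceType) (f : X -> R) (g : Y -> R) :
  is_probability f -> is_probability g ->
  entropy (prod_mass f g) = entropy f + entropy g.
Proof.
move=> pf pg; have pp := prod_mass_prob pf pg.
have N0 (Z : choiceType) (nu : Z -> R) x : is_probability nu -> 0 <= (- ln (nu x))%:E.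
  by move=> pnu; rewrite lee_fin Nln_ge0.
have f0 x := N0 _ f x pf; have g0 y := N0 _ g y pg.
rewrite /entropy Ex_prod//; last by move=> p; apply: N0.
rewrite -[X in _ + X](Ex_cst pf) ?(entropy_ge0 pg)//.
rewrite -ExD//; last by move=> x; apply: (entropy_ge0 pg).
apply: eq_Ex => // x x0; rewrite -[X in X + _](Ex_cst pg)// -ExD//.
apply: eq_Ex => // y y0; rewrite -EFinD; congr EFin.
by rewrite /prod_mass /= lnM ?posrE// opprD.
Qed.

End EntropyRate.

(** * Finite entropy from a finite first moment *)

Section FiniteEntropy.
Variable R : realType.
Local Open Scope ereal_scope.

Lemma esum_swap (X Y : choiceType) (a : X -> Y -> \bar R) :
  (forall x y, 0 <= a x y) ->
  \esum_(x in [set: X]) \esum_(y in [set: Y]) a x y =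
  \esum_(y in [set: Y]) \esum_(x in [set: X]) a x y.
Proof.
move=> a0; rewrite esum_esum//.
rewrite (@esum_esum _ _ _ [set: Y] (fun=> [set: X]) (fun y x => a x y))//.
rewrite (reindex_esum ([set: Y] `*`` (fun=> [set: X])) _ (fun p => (p.2, p.1)))//.
split=> //= [[y x] [y' x'] _ _ [-> ->]//|[x y] _].
by exists (y, x).
Qed.

Lemma uniform_prob (X : choiceType) (F : {fset X}) : (0 < #|` F|)%N ->
  is_probability (fun x => (x \in F)%:R / #|` F|%:R : R)%R.
Proof.
move=> F0; split=> [x|]; first by rewrite divr_ge0.
transitivity (\esum_(x in [set` F]) (#|` F|%:R^-1 : R)%R%:E).
  rewrite [RHS]esum_mkcond; apply: eq_esum => x _.
  by rewrite mem_setE; case: (x \in F); rewrite ?mul1r ?mul0r.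
rewrite esum_fset//.
rewrite fsbig_finite//= set_fsetK sumEFin big_const_seq count_predT iter_addr_0.
by rewrite -(mulr_natl _^-1) mulfV// pnatr_eq0 -lt0n.
Qed.

(** This is ln t <= t - 1 at t = q / p. *)
Lemma gibbs_pointwise (p q : R) : (0 <= p)%R -> (0 < q)%R ->
  (p * - ln p <= p * - ln q + q)%R.
Proof.
move=> p0 q0; move: p0; rewrite le_eqVlt => /predU1P[<-|p0].
  by rewrite !mul0r add0r ltW.
have le : (ln (q / p) <= q / p - 1)%R.
  have := @le_ln1Dx _ (q / p - 1)%R; rewrite addrCA subrr addr0; apply.
  by rewrite ltrDr divr_gt0.
move: le; rewrite (ln_div q0 p0) => le.
have := ler_wpM2l (ltW p0) le.
have -> : (p * (q / p - 1) = q - p)%R.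
  by rewrite mulrBr mulr1 mulrCA mulfV ?gt_eqF// mulr1.
by move: (ln p) (ln q) => a b; lra.
Qed.

Lemma geometric_weight_sum :
  \esum_(n in [set: nat]) (((2 ^ n.+1)%:R^-1 : R)%R)%:E <= 1.
Proof.
rewrite -nneseries_esumT; last by move=> n; rewrite lee_fin invr_ge0.
have := @epsilon_trick0 R 1%R xpredT ler01; apply: le_trans.
by apply: lee_nneseries => [n|n] *; rewrite ?div1r// lee_fin invr_ge0.
Qed.

(** By gibbs_pointwise it is enough to have a summable weight q such that - ln q
    is an affine function of the word norm. The uniform walk on the
    generators, their inverses and 1 gives x a mass of at least a^|x| at time
    |x|; damping time n by 2^-(n+1) makes the sum over all times at most 1. *)
Lemma first_moment_entropy (G : groupType) (mu : G -> R) :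
  is_probability mu -> finite_first_moment mu -> entropy mu < +oo.
Proof.
move=> pmu [S fgS mom]; have [finS _] := fgS.
pose T : set G := S `|` [set s^-1%g | s in S].
have finT : finite_set T.
  by rewrite finite_setU; split=> //; apply: finite_image.
pose F : {fset G} := (1%g |` fset_set T)%fset.
have F0 : (0 < #|` F|)%N by rewrite cardfs_gt0; apply/fset0Pn; exists 1%g; rewrite fset1U1.
have FR0 : (0 < #|` F|%:R :> R)%R by rewrite ltr0n.
pose u (x : G) : R := ((x \in F)%:R / #|` F|%:R)%R.
have pu : is_probability u by exact: uniform_prob.
pose a : R := (#|` F|%:R^-1)%R.
have a0 : (0 < a)%R by rewrite invr_gt0.
have a1 : (a <= 1)%R by rewrite invf_le1// ler1n.
have wordF w : (forall s, s \in w -> S s \/ S s^-1%g) ->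
    (\prod_(s <- w) u s = a ^+ size w)%R.
  elim: w => [|s w IHw] wS; first by rewrite big_nil expr0.
  rewrite big_cons exprS IHw; last by move=> t tw; apply: wS; rewrite inE tw orbT.
  congr (_ * _)%R; rewrite /u (_ : s \in F) ?mul1r//.
  rewrite in_fset1U in_fset_set//; apply/orP; right; apply/mem_set.
  have [|] := wS s (mem_head _ _); first by left.
  by right; exists s^-1%g => //; rewrite invgK.
have lb x : (a ^+ word_norm S x <= convolution_power u (word_norm S x) x)%R.
  have [w [sw wS wx]] := word_normP fgS x.
  by have := power_ge_prod w pu; rewrite wordF// sw wx.
pose q x : R := ((2 ^ (word_norm S x).+1)%:R^-1 * a ^+ word_norm S x)%R.
have w0 n : (0 < (2 ^ n)%:R^-1 :> R)%R by rewrite invr_gt0 ltr0n expn_gt0.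
have q0 x : (0 < q x)%R by rewrite mulr_gt0// exprn_gt0.
have p0 n z : (0 <= convolution_power u n z)%R.
  by apply: prob_ge0; exact: convolution_power_prob.
have g0 n z : 0 <= (((2 ^ n.+1)%:R^-1 * convolution_power u n z)%R : R)%:E.
  by rewrite lee_fin mulr_ge0// ltW.
have qsum : \esum_(x in [set: G]) (q x)%:E <= 1.
  apply: le_trans geometric_weight_sum.
  apply: (@le_trans _ _ (\esum_(x in [set: G]) \esum_(n in [set: nat])
      (((2 ^ n.+1)%:R^-1 * convolution_power u n x)%R : R)%:E)).
    apply: le_esum => x _; apply: esum_ge; exists [set word_norm S x].
      by split=> [|_ ->]; [exact: finite_set1|].
    by rewrite fsbig_set1 lee_fin ler_pM2l.
  rewrite esum_swap//; apply: le_esum => n _.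
  under eq_esum do rewrite EFinM.
  rewrite esumZl ?lee_fin ?(ltW (w0 _))//; last by move=> z _; rewrite lee_fin.
  by rewrite [X in _ * X](convolution_power_prob n pu).2 mule1.
pose K : R := (ln 2 - ln a)%R.
have K0 : (0 <= K)%R by rewrite subr_ge0; apply: le_trans (ln_le0 a1) _; rewrite ln_ge0// ler1n.
have lnq x : (- ln (q x) = (word_norm S x)%:R * K + ln 2)%R.
  rewrite /q lnM ?posrE ?exprn_gt0// lnV ?posrE ?ltr0n ?expn_gt0// natrX !lnXn//.
  rewrite -(mulr_natl (ln 2)) -(mulr_natl (ln a)) /K; set n := word_norm S x; rewrite -(natr1 n).
  by move: (ln 2) (ln a) => c d; lra.
have arith (b n c d e : R) : (b * (n * c + d) + e <= c * (n * b) + (d * b + e))%R.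
  by clear; lra.
have ln20 : (0 <= ln 2 :> R)%R by rewrite ln_ge0// ler1n.
apply: (@le_lt_trans _ _ (\esum_(x in [set: G])
   (K%:E * ((word_norm S x)%:R * mu x)%:E + ((ln 2)%:E * (mu x)%:E + (q x)%:E)))).
  apply: le_esum => x _; have := gibbs_pointwise (prob_ge0 pmu x) (q0 x).
  rewrite lnq -lee_fin => /le_trans; apply; rewrite -!EFinM -!EFinD lee_fin.
  exact: arith.
have mu0 x : 0 <= (mu x)%:E by rewrite lee_fin prob_ge0.
have lm0 x : 0 <= ((word_norm S x)%:R * mu x)%:E by rewrite lee_fin mulr_ge0// prob_ge0.
have qE0 x : 0 <= (q x)%:E by rewrite lee_fin ltW.
have KE0 : 0 <= K%:E by rewrite lee_fin.
have lE0 : 0 <= (ln 2 : R)%:E by rewrite lee_fin.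
rewrite esumD//; [|by move=> x _; rewrite mule_ge0|
  by move=> x _; rewrite adde_ge0// mule_ge0].
rewrite esumZl// esumD//; last by move=> x _; rewrite mule_ge0.
rewrite esumZl// [X in (ln 2)%:E * X](pmu.2) mule1.
apply: lte_add_pinfty; first by rewrite lte_mul_pinfty// fin_numE.
apply: lte_add_pinfty; first exact: ltry.
exact: le_lt_trans qsum (ltry _).
Qed.

End FiniteEntropy.

(** * Zero asymptotic entropy and invariant means *)

Section ZeroEntropy.
Variable R : realType.
Local Open Scope ereal_scope.

(** Let s and t be the square roots of u and v. From ln x <= x - 1 at t / s one
    gets u ln (u / v) - u + v >= (s - t)^2, while |u - v| = |s - t| (s + t) splits
    by the inequality of arithmetic and geometric means. This is Pinsker's
    inequality in a form that is linear in the divergence, hence can be summed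
    over steps and times. *)
Lemma pinsker_pointwise (u v e : R) : (0 <= u)%R -> (0 <= v)%R -> (0 < e)%R ->
  ((0 < u)%R -> (0 < v)%R) ->
  (`|u - v| + (2 * e)^-1 * (u * - ln u + u) <=
     (2 * e)^-1 * (u * - ln v + v) + e * (u + v))%R.
Proof.
move=> u0 v0 e0 uv; set k := ((2 * e)^-1)%R.
have k0 : (0 < k)%R by rewrite invr_gt0 mulr_gt0.
have ke : (2 * (e * k) = 1)%R by rewrite mulrA mulfV// mulf_neq0// gt_eqF.
have amgm (a b : R) : (a * b <= k * a ^+ 2 + e / 2 * b ^+ 2)%R.
  have : (0 <= k * (a - e * b) ^+ 2)%R by rewrite mulr_ge0 ?sqr_ge0// ltW.
  have -> : (k * (a - e * b) ^+ 2 = k * a ^+ 2 - (2 * (e * k)) * (a * b) +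
      (2 * (e * k)) * (e / 2 * b ^+ 2))%R by rewrite !expr2; lra.
  by rewrite ke; lra.
move: u0; rewrite le_eqVlt => /predU1P[<-|u0].
  have ke1 : (1 <= k + e)%R by have := amgm 1%R 1%R; rewrite !expr1n; lra.
  have : (1 * v <= (k + e) * v)%R by apply: ler_wpM2r.
  by rewrite sub0r normrN ger0_norm// !mul0r; lra.
have {}v0 := uv u0.
have root (x : R) : (0 < x)%R -> exists2 r : R, (0 < r)%R & x = (r ^+ 2)%R.
  by move=> x0; exists (Num.sqrt x); [rewrite sqrtr_gt0|rewrite sqr_sqrtr// ltW].
have [s s0 us] := root u u0; have [t t0 vt] := root v v0.
have lnb : (u * (ln v - ln u) <= 2 * (s * t) - 2 * s ^+ 2)%R.
  have -> : (ln v - ln u = 2 * ln (t / s))%R.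
    rewrite us vt !expr2 (lnM t0 t0) (lnM s0 s0) (ln_div t0 s0).
    by move: (ln s) (ln t) => a b; lra.
  have le : (ln (t / s) <= t / s - 1)%R.
    have := @le_ln1Dx _ (t / s - 1)%R; rewrite addrCA subrr addr0; apply.
    by rewrite ltrDr divr_gt0.
  have us0 : (0 <= 2 * u)%R by rewrite mulr_ge0 // ltW.
  have := ler_wpM2l us0 le.
  have -> : (2 * u * (t / s - 1) = 2 * (s * t) - 2 * s ^+ 2)%R.
    have st : (s * s * (t / s) = s * t)%R by rewrite mulrCA mulfK ?gt_eqF// mulrC.
    by rewrite us expr2 mulrBr mulr1 -mulrA st.
  by rewrite (mulrCA u) (mulrA 2%R u).
have dist : (`|u - v| = `|s - t| * (s + t))%R.
  by rewrite us vt subr_sqr normrM (ger0_norm (addr_ge0 (ltW s0) (ltW t0))).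
have h1 := amgm `|s - t|%R (s + t)%R; rewrite -dist real_normK ?num_real// in h1.
have h2 : (k * (u * (ln v - ln u)) <= k * (2 * (s * t) - 2 * s ^+ 2))%R by rewrite ler_pM2l.
have h3 : (0 <= e * (s - t) ^+ 2)%R by rewrite mulr_ge0 ?sqr_ge0// ltW.
move: h1 h2 h3; move: `|u - v|%R (ln u) (ln v) => D a b; rewrite us vt !expr2; lra.
Qed.

Lemma esum_translate (G : groupType) (x : G) (F : G -> G -> \bar R) :
  \esum_(z in [set: G]) F (x^-1 * z)%g z = \esum_(w in [set: G]) F w (x * w)%g.
Proof.
rewrite (reindex_esum [set: G] _ (fun w => (x * w)%g)).
  by apply: eq_esum => w _; rewrite mulKg.
split=> // [w w' _ _ /mulgI//|z _]; by exists (x^-1 * z)%g; rewrite ?mulVKg.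
Qed.

Section Increments.
Variables (G : groupType) (f : G -> R).
Hypothesis pf : is_probability f.
Local Notation pow n := (convolution_power f n).

(** The l^1 distance between the laws of x w_n and of w_(n+1). *)
Definition step_dist n x : \bar R :=
  \esum_(z in [set: G]) (`|pow n (x^-1 * z)%g - pow n.+1 z|)%:E.

Lemma step_dist_ge0 n x : 0 <= step_dist n x.
Proof. by apply: esum_ge0 => z _; rewrite lee_fin. Qed.

Let ppow n : is_probability (pow n) := convolution_power_prob n pf.

Lemma mass_total n : \esum_(z in [set: G]) (pow n z)%:E = 1.
Proof. exact: (ppow n).2. Qed.

(** This is pinsker_pointwise summed over z: the law of x w_n has the entropy of
    w_n, and the expectation on the right is its cross entropy with w_(n+1). *)
Lemma step_dist_le n x (e : R) : (0 < e)%R -> (0 < f x)%R ->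
  step_dist n x + ((2 * e)^-1)%R%:E * (entropy (pow n) + 1) <=
  ((2 * e)^-1)%R%:E *
    (Ex (pow n) (fun w => (- ln (pow n.+1 (x * w)%g))%:E) + 1) + (2 * e)%:E.
Proof.
move=> e0 fx; set k := ((2 * e)^-1)%R.
have k0 : (0 <= k)%R by rewrite invr_ge0 mulr_ge0// ltW.
have p0 m z : (0 <= pow m z)%R by exact: prob_ge0.
have L0 m z : (0 <= - ln (pow m z))%R by exact: Nln_ge0.
have sumu : \esum_(z in [set: G]) (pow n (x^-1 * z)%g)%:E = 1.
  by rewrite (esum_translate x (fun w _ => (pow n w)%:E)) mass_total.
have -> : entropy (pow n) = \esum_(z in [set: G])
    ((pow n (x^-1 * z)%g)%:E * (- ln (pow n (x^-1 * z)%g))%:E).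
  by rewrite (esum_translate x (fun w _ => (pow n w)%:E * (- ln (pow n w))%:E)).
have -> : Ex (pow n) (fun w => (- ln (pow n.+1 (x * w)%g))%:E) =
    \esum_(z in [set: G]) ((pow n (x^-1 * z)%g)%:E * (- ln (pow n.+1 z))%:E).
  by rewrite (esum_translate x (fun w z => (pow n w)%:E * (- ln (pow n.+1 z))%:E)).
rewrite -{1}sumu -{1}(mass_total n.+1).
have -> : (2 * e)%:E = e%:E * (\esum_(z in [set: G]) (pow n (x^-1 * z)%g)%:E +
    \esum_(z in [set: G]) (pow n.+1 z)%:E).
  by rewrite sumu mass_total -EFinD -EFinM mulrC.
rewrite /step_dist.
have P0 z : 0 <= (pow n (x^-1 * z)%g)%:E * (- ln (pow n (x^-1 * z)%g))%:E.
  by rewrite -EFinM lee_fin mulr_ge0.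
have Q0 z : 0 <= (pow n (x^-1 * z)%g)%:E * (- ln (pow n.+1 z))%:E.
  by rewrite -EFinM lee_fin mulr_ge0.
have u0 z : 0 <= (pow n (x^-1 * z)%g)%:E by rewrite lee_fin.
have v0 z : 0 <= (pow n.+1 z)%:E by rewrite lee_fin.
have k0E : 0 <= k%:E by rewrite lee_fin.
have e0E : 0 <= e%:E by rewrite lee_fin ltW.
have n0 z : 0 <= (`|pow n (x^-1 * z)%g - pow n.+1 z|)%:E by rewrite lee_fin.
rewrite -!esumD// -!esumZl//; try by move=> z _; rewrite adde_ge0.
rewrite -!esumD//; try by move=> z _; rewrite mule_ge0// adde_ge0.
apply: le_esum => z _.
suff uv : (0 < pow n (x^-1 * z)%g)%R -> (0 < pow n.+1 z)%R.
  have := pinsker_pointwise (p0 n (x^-1 * z)%g) (p0 n.+1 z) e0 uv.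
  by rewrite -lee_fin.
move=> u1; have := convolution_ge x (x^-1 * z)%g pf (ppow n).
rewrite -convolution_powerSl// mulVKg; apply: lt_le_trans.
exact: mulr_gt0.
Qed.

Hypothesis Hfin : entropy f < +oo.

Lemma entropy_power_fin n : entropy (pow n) \is a fin_num.
Proof.
have ff : entropy f \is a fin_num by rewrite ge0_fin_numE// entropy_ge0.
rewrite ge0_fin_numE ?entropy_ge0//.
by apply: le_lt_trans (entropy_power_le n pf (_ : _ <= (fine (entropy f))%:E)) _;
  rewrite ?fineK ?ltry.
Qed.

(** If x is a random step independent of w_n then x w_n has the law of w_(n+1),
    so the cross entropies average to the entropy of w_(n+1). *)
Lemma Ex_step_dist_le n (e : R) : (0 < e)%R ->
  Ex f (step_dist n) + ((2 * e)^-1)%R%:E * entropy (pow n) <=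
  ((2 * e)^-1)%R%:E * entropy (pow n.+1) + (2 * e)%:E.
Proof.
move=> e0; set k := ((2 * e)^-1)%R.
have k0 : (0 <= k)%R by rewrite invr_ge0 mulr_ge0// ltW.
have k0E : 0 <= k%:E by rewrite lee_fin.
have L0 m z : 0 <= (- ln (pow m z))%:E by rewrite lee_fin Nln_ge0.
have H0 m : 0 <= entropy (pow m) by exact: entropy_ge0.
pose W x := Ex (pow n) (fun w => (- ln (pow n.+1 (x * w)%g))%:E).
have W0 x : 0 <= W x by apply: Ex_ge0.
have : Ex f (fun x => step_dist n x + k%:E * (entropy (pow n) + 1)) <=
    Ex f (fun x => k%:E * (W x + 1) + (2 * e)%:E).
  by apply: le_Ex => // x fx; apply: step_dist_le.
have e20 : 0 <= (2 * e)%:E by rewrite lee_fin mulr_ge0// ltW.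
have S0 := step_dist_ge0 n.
have c0 : 0 <= k%:E * (entropy (pow n) + 1) by rewrite mule_ge0// adde_ge0.
have W1 x : 0 <= W x + 1 by rewrite adde_ge0.
have kW x : 0 <= k%:E * (W x + 1) by rewrite mule_ge0.
rewrite ExD// Ex_cst// ExD// Ex_cst// ExZ// ExD// Ex_cst// /W.
rewrite -(Ex_powerSl n pf (L0 n.+1)) -/(entropy (pow n.+1)).
rewrite !ge0_muleDr// mule1 addeA [in leRHS]addeAC leeD2rE//.
Qed.

Lemma sum_step_dist_le N (e : R) : (0 < e)%R ->
  Ex f (fun x => \sum_(n < N) step_dist n x) <=
  ((2 * e)^-1)%R%:E * entropy (pow N) + (N%:R * (2 * e))%:E.
Proof.
move=> e0; have S0 := step_dist_ge0.
elim: N => [|N IHN].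
  rewrite entropy_power0 mule0 mul0r adde0 (_ : (fun _ => _) = fun=> 0).
    by rewrite Ex_cst.
  by apply/funext => x; rewrite big_ord0.
rewrite (_ : (fun _ => _) = (fun x => \sum_(n < N) step_dist n x + step_dist N x)); last first.
  by apply/funext => x; rewrite big_ord_recr.
rewrite ExD//; last by move=> x; apply: sume_ge0.
have := Ex_step_dist_le N e0.
set k := ((2 * e)^-1)%R; set a := Ex f _; set b := Ex f _ in IHN * => h.
have kf : k%:E * entropy (pow N) \is a fin_num by rewrite fin_numM// entropy_power_fin.
apply: le_trans (leeD IHN (lexx a)) _.
have -> : (N.+1%:R * (2 * e))%:E = (2 * e)%:E + (N%:R * (2 * e))%:E.
  by rewrite -EFinD -(natr1 N) mulrDl mul1r addrC.
rewrite [leRHS]addeA [leLHS]addeAC; apply: leeD => //.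
by rewrite addeC.
Qed.

End Increments.
End ZeroEntropy.

Section UltraLimit.
Variable R : realType.

Lemma ultra_fmap (T U : Type) (F : set_system T) (f : T -> U) :
  UltraFilter F -> UltraFilter (f @ F).
Proof.
move=> FU; split; first exact: fmap_proper_filter.
move=> D DF sub; apply/seteqP; split=> [A DA|A]; last exact: sub.
have [//|FnA] := in_ultra_setVsetC (f @^-1` A) FU.
have DnA : D (~` A) by apply: sub; rewrite /= preimage_setC.
by have [x []] := filter_ex (filterI DA DnA).
Qed.

Lemma ultra_limit (T : Type) (F : set_system T) (a : T -> R) : UltraFilter F ->
  (forall t, 0 <= a t <= 1) -> exists2 l : R, 0 <= l <= 1 & a @ F --> l.
Proof.
move=> FU a01; have aU := ultra_fmap a FU.
have := @segment_compact R 0 1; rewrite compact_ultra => /(_ _ aU) [].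
  by apply: (@filterE _ F) => t /=; rewrite in_itv /=; apply: a01.
by move=> l [/= l01 al]; exists l => //; move: l01; rewrite in_itv.
Qed.

End UltraLimit.

Section InvariantMean.
Variables (R : realType) (G : groupType) (f : G -> R).
Hypothesis pf : is_probability f.
Hypothesis Hfin : (entropy f < +oo)%E.
Local Notation pow n := (convolution_power f n).
Implicit Types (A B : set G) (x : G).

Definition mass_real n A : R := fine (mass_of (pow n) A).

Lemma mass_realE n A : (mass_real n A)%:E = mass_of (pow n) A.
Proof. by rewrite fineK// mass_of_fin//; apply: convolution_power_prob. Qed.

Lemma mass_real01 n A : 0 <= mass_real n A <= 1.
Proof.
have pn := convolution_power_prob n pf.
by rewrite -!lee_fin mass_realE mass_of_ge0// mass_of_le1.
Qed.

Lemma mass_realT n : mass_real n setT = 1.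
Proof. by apply: EFin_inj; rewrite mass_realE (convolution_power_prob n pf).2. Qed.

Lemma mass_realU n A B : A `&` B = set0 ->
  mass_real n (A `|` B) = mass_real n A + mass_real n B.
Proof.
move=> AB; have pn := convolution_power_prob n pf.
apply: EFin_inj; rewrite EFinD !mass_realE !mass_of_Ex -ExD//.
apply: eq_Ex => // x _; rewrite -EFinD !indicE in_setU.
case: (boolP (x \in A)) => xA; case: (boolP (x \in B)) => xB /=;
  rewrite ?addr0 ?add0r//.
move: xA xB; rewrite !inE => xA xB.
by suff : set0 x by []; rewrite -AB.
Qed.

Lemma mass_step n x A :
  (`|mass_real n [set w | A (x * w)%g] - mass_real n.+1 A|%:E <= step_dist f n x)%E.
Proof.
have pn m := convolution_power_prob m pf.
pose u z := pow n (x^-1 * z)%g.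
have uE : mass_of (pow n) [set w | A (x * w)%g] = (\esum_(z in A) (u z)%:E)%R.
  rewrite /mass_of esum_mkcond [RHS]esum_mkcond.
  rewrite -(esum_translate x (fun w z => if z \in A then (pow n w)%:E else 0)%E).
  by [].
have u0 z : 0 <= u z := prob_ge0 (pn n) _.
have v0 z : 0 <= pow n.+1 z := prob_ge0 (pn n.+1) z.
have D0 (B : set G) : (0 <= \esum_(z in B) `|u z - pow n.+1 z|%:E)%E.
  by apply: esum_ge0 => z _; rewrite lee_fin.
have DA : (\esum_(z in A) `|u z - pow n.+1 z|%:E <= step_dist f n x)%E.
  rewrite /step_dist (esumID A setT); last by move=> z _; rewrite lee_fin.
  by rewrite !setTI; apply: leeDl; exact: D0.
have le1 : (mass_of (pow n) [set w | A (x * w)%g] <= mass_of (pow n.+1) A + step_dist f n x)%E.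
  rewrite uE; apply: le_trans (leeD (lexx _) DA).
  rewrite -esumD; [|by move=> z _; rewrite lee_fin..].
  apply: le_esum => z _; rewrite -EFinD lee_fin.
  by rewrite -lerBlDl ler_norm.
have le2 : (mass_of (pow n.+1) A <= mass_of (pow n) [set w | A (x * w)%g] + step_dist f n x)%E.
  rewrite uE; apply: le_trans (leeD (lexx _) DA).
  rewrite -esumD; [|by move=> z _; rewrite lee_fin..].
  apply: le_esum => z _; rewrite -EFinD lee_fin.
  by rewrite -lerBlDl distrC ler_norm.
move: le1 le2; rewrite -!mass_realE.
case: (step_dist f n x) (step_dist_ge0 f n x) => [r||]//= _.
  by rewrite -!EFinD !lee_fin ler_norml; lra.
by move=> *; rewrite leey.
Qed.

Definition cesaro N A : R := (\sum_(n < N) mass_real n A) / N%:R.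

(** Shifting the average by x compares, at each time n < N, the law of x w_n
    with that of w_(n+1); re-indexing the times costs two boundary terms. *)
Lemma cesaro_step N x A (e : R) : (0 < N)%N -> 0 < e -> 0 < f x ->
  (entropy (pow N) <= (N%:R * e ^+ 2)%:E)%E ->
  f x * `|cesaro N [set w | A (x * w)%g] - cesaro N A| <= 3 * e + N%:R^-1.
Proof.
move=> N0 e0 fx HN; have NR0 : 0 < N%:R :> R by rewrite ltr0n.
have fx1 : f x <= 1 by exact: prob_le1.
pose D n := mass_real n [set w | A (x * w)%g] - mass_real n.+1 A.
have SD : f x * \sum_(n < N) `|D n| <= N%:R * (3 * e).
  rewrite -lee_fin.
  apply: (@le_trans _ _ ((f x)%:E * (\sum_(n < N) step_dist f n x))%E).
    rewrite EFinM; apply: lee_wpmul2l; first by rewrite lee_fin ltW.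
    by rewrite -sumEFin; apply: lee_sum => n _; apply: mass_step.
  have S0 y : (0 <= \sum_(n < N) step_dist f n y)%E.
    by apply: sume_ge0 => n _; apply: step_dist_ge0.
  apply: (@le_trans _ _ (Ex f (fun y => \sum_(n < N) step_dist f n y)%E)).
    apply: esum_ge; exists [set x]; last by rewrite fsbig_set1.
    by split=> [|_ ->]; [exact: finite_set1|].
  apply: le_trans (sum_step_dist_le pf Hfin N e0) _.
  apply: (@le_trans _ _ (((2 * e)^-1)%:E * (N%:R * e ^+ 2)%:E + (N%:R * (2 * e))%:E)%E).
    apply: leeD => //; apply: lee_wpmul2l => //.
    by rewrite lee_fin invr_ge0 mulr_ge0// ltW.
  rewrite -EFinM -EFinD lee_fin.
  have -> : (2 * e)^-1 * (N%:R * e ^+ 2) = N%:R * (e / 2).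
    rewrite mulrCA; congr (_ * _); rewrite invfM expr2 -mulrA mulKf ?gt_eqF//.
    by rewrite mulrC.
  by rewrite -mulrDr ler_pM2l//; lra.
have -> : cesaro N [set w | A (x * w)%g] - cesaro N A =
    (\sum_(n < N) D n + (mass_real N A - mass_real 0 A)) / N%:R.
  rewrite /cesaro -mulrBl; congr (_ / _); rewrite /D big_split /= sumrN -addrA.
  congr (_ + _); have := telescope_sumr (mass_real^~ A) (leq0n N).
  by rewrite big_mkord big_split /= sumrN => <-; lra.
rewrite normrM (ger0_norm (_ : 0 <= N%:R^-1)) ?invr_ge0// mulrA ler_pdivrMr//.
rewrite mulrDl mulVf ?gt_eqF//; apply: le_trans (_ : f x * (\sum_(n < N) `|D n| + 1) <= _).
  rewrite ler_pM2l//; apply: le_trans (ler_normD _ _) _; apply: lerD.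
    exact: ler_norm_sum.
  have /andP[a0 a1] := mass_real01 N A; have /andP[b0 b1] := mass_real01 0 A.
  by rewrite ler_norml; lra.
by rewrite mulrDr mulr1; move: SD; lra.
Qed.

(** At zero entropy rate the Cesaro averages of the convolution powers are
    asymptotically invariant under each element of the support, and an ultralimit
    of them is exactly invariant under the group that the support generates. *)
Lemma zero_rate_invariant_mean :
  (forall (e : R) (M : nat), 0 < e -> exists N, [/\ (M < N)%N &
     (entropy (pow N) <= (N%:R * e)%:E)%E]) ->
  exists m, invariant_mean (gen_subgroup (support_of f)) (m : set G -> R).
Proof.
move=> small.
pose e (j : nat) : R := j.+1%:R^-1.
have e0 j : 0 < e j by rewrite invr_gt0 ltr0n.
have /choice[N NP] : forall j, exists N, (j < N)%N /\
    (entropy (pow N) <= (N%:R * e j ^+ 2)%:E)%E.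
  by move=> j; have [N [? ?]] := small (e j ^+ 2) j (exprn_gt0 2 (e0 j)); exists N.
have N0 j : (0 < N j)%N by have [+ _] := NP j; apply: leq_trans.
have NR0 j : 0 < (N j)%:R :> R by rewrite ltr0n.
(* At the times N j the Cesaro averages have a defect of order e j. *)
have [U [UU subU]] := ultraFilterLemma (@eventually_filter).
have c01 A j : 0 <= cesaro (N j) A <= 1.
  rewrite /cesaro divr_ge0 ?sumr_ge0//=; last by move=> n _; case/andP: (mass_real01 n A).
  rewrite ler_pdivrMr// mul1r -[leRHS](_ : \sum_(n < N j) 1 = _); last first.
    by rewrite sumr_const card_ord.
  by apply: ler_sum => n _; case/andP: (mass_real01 n A).
have /choice[m mP] : forall A, exists l : R, 0 <= l <= 1 /\ (fun j => cesaro (N j) A) @ U --> l.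
  by move=> A; have [l ? ?] := ultra_limit UU (c01 A); exists l.
exists m.
have uniq (a : nat -> R) (l l' : R) : a @ U --> l -> a @ U --> l' -> l = l'.
  by apply: cvg_unique; exact: norm_hausdorff.
have inv x A : 0 < f x -> m [set w | A (x * w)%g] = m A.
  move=> fx; apply/eqP; rewrite -subr_eq0; apply/eqP.
  apply: (uniq (fun j => cesaro (N j) [set w | A (x * w)%g] - cesaro (N j) A)).
    by apply: cvgB; [exact: (mP _).2|exact: (mP _).2].
  apply/cvgrPdist_le => eps eps0.
  suff : \forall j \near \oo, `|0 - (cesaro (N j) [set w | A (x * w)%g] - cesaro (N j) A)| <= eps.
    by move=> h; apply: subU.
  have d0 : 0 < f x * eps / 4 by rewrite divr_gt0// mulr_gt0.
  have small_e : \forall j \near \oo, e j < f x * eps / 4.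
    exact: (near_infty_natSinv_lt (PosNum d0)).
  near=> j.
  have ej : e j < f x * eps / 4 by near: j.
  rewrite sub0r normrN -(ler_pM2l fx).
  have [jN HN] := NP j.
  apply: le_trans (cesaro_step A (N0 j) (e0 j) fx HN) _.
  have : (N j)%:R^-1 <= e j :> R by rewrite lef_pV2 ?posrE// ler_nat.
  by move: ej; lra.
split.
- apply: (uniq (fun j => cesaro (N j) setT)); first exact: (mP _).2.
  rewrite (_ : (fun j => _) = fun=> 1); first exact: cvg_cst.
  apply/funext => j; rewrite /cesaro (eq_bigr (fun=> 1)); last first.
    by move=> n _; rewrite mass_realT.
  by rewrite sumr_const card_ord divff// gt_eqF.
- by move=> A; have [/andP[]] := mP A.
- move=> A B AB; apply: (uniq (fun j => cesaro (N j) (A `|` B))); first exact: (mP _).2.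
  rewrite (_ : (fun j => _) = (fun j => cesaro (N j) A + cesaro (N j) B)).
    by apply: cvgD; [exact: (mP _).2|exact: (mP _).2].
  apply/funext => j; rewrite /cesaro -mulrDl -big_split /=; congr (_ / _).
  by apply: eq_bigr => n _; rewrite mass_realU.
pose I := [set x | forall A, m [set w | A (x * w)%g] = m A].
suff sub : gen_subgroup (support_of f) `<=` I by move=> x A /sub; apply.
apply: gen_subgroup_min; last by move=> x fx A; apply: inv.
split=> [A|x y Ix Iy A].
  by congr m; apply/seteqP; split=> w /=; rewrite mul1g.
pose B := [set w | A (x * w)%g].
rewrite -(Ix A) -/B.
rewrite (_ : [set w | A (x * y^-1 * w)%g] = [set w | B (y^-1 * w)%g]); last first.
  by apply/seteqP; split=> w; rewrite /B /= mulgA.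
rewrite -(Iy [set w | B (y^-1 * w)%g]).
by congr m; apply/seteqP; split=> w /=; rewrite mulKg.
Unshelve. all: by end_near. Qed.

End InvariantMean.

(** * The noisy pair *)

Section Noise.
Variables (R : realType).
Local Open Scope ereal_scope.

Section NoiseMass.
Variables (X : choiceType) (f : X -> R) (rho : R).
Hypotheses (pf : is_probability f) (rho01 : (0 <= rho <= 1)%R).

Lemma Ex_noise (phi : X * X -> \bar R) : (forall p, 0 <= phi p) ->
  Ex (noise_mass rho f) phi =
  rho%:E * Ex f (fun x => Ex f (fun y => phi (x, y))) +
  (1 - rho)%:E * Ex f (fun x => phi (x, x)).
Proof.
move=> p0; have /andP[r0 r1] := rho01.
have r1' : (0 <= 1 - rho)%R by rewrite subr_ge0.
have pp := prod_mass_prob pf pf.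
have d0 p : (0 <= diag_mass f p)%R by rewrite /diag_mass; case: ifP => // _; exact: prob_ge0.
have m0 (g : X * X -> R) p : (0 <= g p)%R -> 0 <= (g p)%:E * phi p.
  by move=> ?; rewrite mule_ge0.
rewrite -Ex_prod// -Ex_diag// /Ex -!esumZl//; last 2 first.
- by move=> p _; apply: m0.
- by move=> p _; apply: m0; apply: prob_ge0.
rewrite -esumD; last 2 first.
- by move=> p _; rewrite mule_ge0 ?lee_fin// m0// prob_ge0.
- by move=> p _; rewrite mule_ge0 ?lee_fin// m0.
apply: eq_esum => p _; rewrite /noise_mass EFinD ge0_muleDl.
- by rewrite !EFinM !muleA.
- by rewrite lee_fin mulr_ge0// prob_ge0.
- by rewrite lee_fin mulr_ge0.
Qed.

Lemma noise_mass_prob : is_probability (noise_mass rho f).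
Proof.
have /andP[r0 r1] := rho01; split=> [p|].
  have d0 : (0 <= diag_mass f p)%R.
    by rewrite /diag_mass; case: ifP => // _; exact: prob_ge0.
  by rewrite /noise_mass addr_ge0// !mulr_ge0// ?subr_ge0//; exact: prob_ge0.
transitivity (Ex (noise_mass rho f) (fun=> 1)).
  by apply: eq_esum => x _; rewrite mule1.
have E1 : Ex f (fun=> 1) = 1 by exact: Ex_cst.
by rewrite Ex_noise// !E1 !mule1 -EFinD addrC subrK.
Qed.

End NoiseMass.

Section NoisePower.
Variables (G : groupType) (mu : G -> R) (rho : R).
Hypotheses (pmu : is_probability mu) (rho01 : (0 < rho < 1)%R).
Local Notation noise := (noise_mass rho mu).
Local Notation mu2 := (prod_mass mu mu).
Local Notation pow := convolution_power.

Let rho0 : (0 <= rho)%R. Proof. by case/andP: rho01 => /ltW. Qed.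
Let rho1 : (0 <= 1 - rho)%R. Proof. by case/andP: rho01 => _ /ltW; rewrite subr_ge0. Qed.
Let rho01' : (0 <= rho <= 1)%R. Proof. by case/andP: rho01 => /ltW -> /ltW ->. Qed.
Let pnoise : is_probability noise. Proof. exact: noise_mass_prob. Qed.
Let pmu2 : is_probability mu2. Proof. exact: prod_mass_prob. Qed.

(** With probability rho^n every step is resampled. *)
Lemma noise_ge_indep n (phi : G * G -> \bar R) : (forall p, 0 <= phi p) ->
  (rho ^+ n)%:E * Ex (pow mu2 n) phi <= Ex (pow noise n) phi.
Proof.
elim: n phi => [|n IHn] phi p0; first by rewrite !Ex_power0// mul1e.
have E0 (nu : G * G -> R) w : is_probability nu ->
    0 <= Ex nu (fun p => phi (w * p)%g) by move=> pnu; apply: Ex_ge0.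
rewrite !Ex_powerSr//.
apply: (@le_trans _ _ (Ex (pow noise n) (fun w => rho%:E * Ex mu2 (fun p => phi (w * p)%g)))).
  rewrite ExZ ?lee_fin//; last 2 first.
  - exact: convolution_power_prob.
  - by move=> w; apply: E0.
  rewrite exprS EFinM -muleA; apply: lee_wpmul2l; first by rewrite lee_fin.
  by apply: IHn => w; apply: E0.
apply: le_Ex; first exact: convolution_power_prob.
move=> w _; rewrite Ex_noise// Ex_prod// leeDl// mule_ge0 ?lee_fin//.
exact: Ex_ge0.
Qed.

(** With probability (1 - rho)^n no step is resampled, and then the two
    coordinates agree. *)
Lemma noise_ge_diag n (phi : G * G -> \bar R) : (forall p, 0 <= phi p) ->
  ((1 - rho) ^+ n)%:E * Ex (pow mu n) (fun x => phi (x, x)) <= Ex (pow noise n) phi.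
Proof.
elim: n phi => [|n IHn] phi p0; first by rewrite !Ex_power0// mul1e.
rewrite !Ex_powerSr//.
pose psi (w : G * G) := Ex mu (fun x => phi (w * (x, x))%g).
have psi0 w : 0 <= psi w by apply: Ex_ge0.
apply: (@le_trans _ _ (Ex (pow noise n) (fun w => (1 - rho)%:E * psi w))).
  rewrite ExZ ?lee_fin//; last exact: convolution_power_prob.
  rewrite exprS EFinM -muleA; apply: lee_wpmul2l; first by rewrite lee_fin.
  exact: IHn.
apply: le_Ex; first exact: convolution_power_prob.
move=> w _; rewrite Ex_noise// leeDr// mule_ge0 ?lee_fin//.
by apply: Ex_ge0 => // x; apply: Ex_ge0.
Qed.

Lemma noise_fst n (psi : G -> \bar R) : (forall x, 0 <= psi x) ->
  Ex (pow noise n) (fun p => psi p.1) = Ex (pow mu n) psi.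
Proof.
elim: n psi => [|n IHn] psi p0; first by rewrite !Ex_power0.
rewrite !Ex_powerSr//.
have E0 x : 0 <= Ex mu (fun y => psi (x * y)%g) by apply: Ex_ge0.
rewrite -IHn//; apply: eq_Ex; first exact: convolution_power_prob.
move=> w _; rewrite Ex_noise//=.
rewrite [X in rho%:E * X](_ : _ = Ex mu (fun x => psi (w.1 * x)%g)); last first.
  by apply: eq_Ex => // x _; rewrite Ex_cst.
by rewrite -ge0_muleDl ?lee_fin// -EFinD addrC subrK mul1e.
Qed.

Lemma noise_snd n (psi : G -> \bar R) : (forall x, 0 <= psi x) ->
  Ex (pow noise n) (fun p => psi p.2) = Ex (pow mu n) psi.
Proof.
elim: n psi => [|n IHn] psi p0; first by rewrite !Ex_power0.
rewrite !Ex_powerSr//.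
have E0 x : 0 <= Ex mu (fun y => psi (x * y)%g) by apply: Ex_ge0.
rewrite -IHn//; apply: eq_Ex; first exact: convolution_power_prob.
move=> w _; rewrite Ex_noise//= Ex_cst//.
by rewrite -ge0_muleDl ?lee_fin// -EFinD addrC subrK mul1e.
Qed.

Lemma noise_support n p : (0 < pow noise n p)%R ->
  (0 < pow mu n p.1)%R /\ (0 < pow mu n p.2)%R.
Proof.
move=> pp; have pn := convolution_power_prob n pmu.
have pN := convolution_power_prob n pnoise.
have pos (nu nu' : G -> R) (x : G) (psi : G * G -> G) : psi p = x ->
    is_probability nu' ->
    Ex (pow noise n) (fun q => (\1_[set x] (psi q))%:E) = Ex nu' (fun y => (\1_[set x] y)%:E) ->
    (0 < nu' x)%R.
  move=> px pnu' e; rewrite -lte_fin -mass_of_set1// mass_of_Ex -e.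
  apply: (@lt_le_trans _ _ (pow noise n p)%:E); first by rewrite lte_fin.
  rewrite -mass_of_set1// mass_of_Ex; apply: le_Ex => // q _.
  rewrite lee_fin !indicE ler_nat; case: (boolP (q \in _)) => //.
  by rewrite inE /= => ->; rewrite mem_set.
split; first by apply: (pos mu _ _ fst) => //; apply: (@noise_fst n (fun y => (\1_[set p.1] y)%:E)).
by apply: (pos mu _ _ snd) => //; apply: (@noise_snd n (fun y => (\1_[set p.2] y)%:E)).
Qed.

(** The reference law q has mass at least mu_k(x) / 2 at a diagonal point (x, x)
    and at least mu_k(x) mu_k(y) / 2 at (x, y). So - ln q is at most ln 2, plus
    - ln mu_k(x), plus - ln mu_k(y) off the diagonal only. The diagonal carries at
    least the fraction (1 - rho)^k of the expectation of - ln mu_k(y). *)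
Lemma noise_cross_entropy k (H : R) : entropy (pow mu k) = H%:E ->
  let q := noise_mass 2^-1 (pow mu k) in
  (forall p, (0 < pow noise k p)%R -> (0 < q p)%R) /\
  Ex (pow noise k) (fun p => (- ln (q p))%:E) <=
    (H + ln 2 + (1 - (1 - rho) ^+ k) * H)%:E.
Proof.
move=> EH q; have pk := convolution_power_prob k pmu.
have pN := convolution_power_prob k pnoise.
pose L y : R := (- ln (pow mu k y))%R.
have L0 y : (0 <= L y)%R by exact: Nln_ge0.
have LE0 y : 0 <= (L y)%:E by rewrite lee_fin.
have half : ((1 - 2^-1 : R) = 2^-1)%R by lra.
have h2 : (0 < 2^-1 :> R)%R by rewrite invr_gt0.
have qE x y : q (x, y) = (2^-1 * (pow mu k x * pow mu k y + diag_mass (pow mu k) (x, y)))%R.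
  by rewrite /q /noise_mass half /prod_mass mulrDr.
have d0 p : (0 <= diag_mass (pow mu k) p)%R.
  by rewrite /diag_mass; case: ifP => // _; exact: prob_ge0.
have qpos p : (0 < pow noise k p)%R -> (0 < q p)%R.
  case: p => x y /noise_support[/= x0 y0]; rewrite qE mulr_gt0// ltr_wpDr// mulr_gt0//.
split=> //.
have ln20 : (0 <= ln 2 :> R)%R by rewrite ln_ge0// ler1n.
pose D (p : G * G) : R := if p.1 == p.2 then 0%R else L p.2.
pose D' (p : G * G) : R := if p.1 == p.2 then L p.2 else 0%R.
have D0 p : 0 <= (D p)%:E by rewrite /D; case: ifP; rewrite lee_fin.
have D'0 p : 0 <= (D' p)%:E by rewrite /D'; case: ifP; rewrite lee_fin.
apply: (@le_trans _ _ (Ex (pow noise k) (fun p => (ln 2)%:E + ((L p.1)%:E + (D p)%:E)))).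
  apply: le_Ex => // -[x y] pxy; rewrite -!EFinD lee_fin /D /=.
  have [/= x0 y0] := noise_support pxy.
  have c2 : (- ln (2^-1 : R) = ln 2)%R by rewrite lnV ?opprK// posrE.
  move: (qpos _ pxy) (qE x y); rewrite /diag_mass /=; case: eqP => [<-|_] qp qxy.
    have hx : (0 < 2^-1 * pow mu k x)%R by rewrite mulr_gt0.
    rewrite addr0 -c2 /L -opprD lerN2 -lnM ?posrE// ler_ln ?posrE//.
    by rewrite qxy ler_pM2l// lerDr mulr_ge0// ltW.
  have xy0 : (0 < pow mu k x * pow mu k y)%R by rewrite mulr_gt0.
  by rewrite qxy addr0 -c2 /L -!opprD -lnM ?posrE// -lnM ?posrE.
rewrite ExD//; last by move=> p; rewrite adde_ge0.
rewrite Ex_cst// ExD// (noise_fst k LE0) [X in _ + (X + _)]EH.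
have off : Ex (pow noise k) (fun p => (D p)%:E) <= ((1 - (1 - rho) ^+ k) * H)%:E.
  have split : Ex (pow noise k) (fun p => (D p)%:E) +
      Ex (pow noise k) (fun p => (D' p)%:E) = H%:E.
    rewrite -ExD// -EH; transitivity (Ex (pow noise k) (fun p => (L p.2)%:E)).
      2: by rewrite (noise_snd k LE0).
    apply: eq_Ex => // p _.
    by rewrite /D /D'; case: ifP => _; rewrite ?adde0 ?add0e.
  have diag : ((1 - rho) ^+ k * H)%:E <= Ex (pow noise k) (fun p => (D' p)%:E).
    rewrite EFinM -EH; apply: le_trans (noise_ge_diag k D'0).
    apply: lee_wpmul2l; first by rewrite lee_fin exprn_ge0.
    by apply: le_Ex => // x _; rewrite /D' /= eqxx.
  rewrite mulrBl mul1r EFinB leeBrDr// -split; exact: leeD2l.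
rewrite -addrA addrCA [X in _ <= X](_ : _ = (ln 2)%:E + (H%:E + ((1 - (1 - rho) ^+ k) * H)%:E)).
  by apply: leeD2l; apply: leeD2l.
by rewrite -!EFinD.
Qed.

End NoisePower.
End Noise.

(** * Separation in total variation *)

Section Rate.
Variables (R : realType) (G : groupType) (f : G -> R).
Hypothesis pf : is_probability f.
Hypothesis Hfin : (entropy f < +oo)%E.
Local Notation pow n := (convolution_power f n).

(** The asymptotic entropy, as the infimum of the entropies per step. *)
Lemma entropy_rate_exists : exists h : R, [/\ 0 <= h,
  forall n, ((n%:R * h)%:E <= entropy (pow n))%E &
  forall eps, 0 < eps -> exists2 k, (0 < k)%N &
     (entropy (pow k) <= (k%:R * (h + eps))%:E)%E].
Proof.
pose E n : R := fine (entropy (pow n)).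
have EE n : entropy (pow n) = (E n)%:E by rewrite fineK// entropy_power_fin.
have E0 n : 0 <= E n.
  by rewrite -lee_fin -EE; apply: entropy_ge0; exact: convolution_power_prob.
pose A : set R := [set E n / n%:R | n in [set n | (0 < n)%N]].
have A0 : A !=set0 by exists (E 1%N / 1%:R), 1%N.
have lbA : lbound A 0 by move=> _ [n _ <-]; rewrite divr_ge0.
have infA : has_inf A by split=> //; exists 0.
exists (inf A); split.
- exact: lb_le_inf.
- case=> [|n]; first by rewrite mul0r entropy_power0.
  rewrite EE lee_fin mulrC -ler_pdivlMr ?ltr0n//.
  by apply: ge_inf; [exists 0|exists n.+1].
move=> eps eps0; have [_ [k k0 <-] lt] := inf_adherent eps0 infA.
exists k => //; rewrite EE lee_fin mulrC -ler_pdivrMr ?ltr0n//.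
exact: ltW.
Qed.

Lemma entropy_power_mul_le k j (c : R) : (entropy (pow k) <= (k%:R * c)%:E)%E ->
  (entropy (pow (k * j)) <= ((k * j)%N%:R * c)%:E)%E.
Proof.
move=> h; rewrite convolution_power_mul//.
apply: le_trans (entropy_power_le j (convolution_power_prob k pf) h) _.
by rewrite natrM mulrA (mulrC j%:R).
Qed.

End Rate.

Lemma hyperbolic_positive_rate (R : realType) (G : groupType) (mu : G -> R) :
  hyperbolic_group R G -> is_probability mu -> nonelementary mu ->
  (entropy mu < +oo)%E ->
  exists h : R, [/\ 0 < h,
    forall n, ((n%:R * h)%:E <= entropy (convolution_power mu n))%E &
    forall eps, 0 < eps -> exists2 k, (0 < k)%N &
     (entropy (convolution_power mu k) <= (k%:R * (h + eps))%:E)%E].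
Proof.
move=> [S fgS [delta delta0 hypd]] pmu nel Hfin.
have [h [h0 low up]] := entropy_rate_exists pmu Hfin.
exists h; split=> //; rewrite lt_neqAle h0 andbT; apply/eqP => hz; apply: nel.
have [|m im] := zero_rate_invariant_mean pmu Hfin.
  move=> e M e0; have [k k0] := up e e0; rewrite -hz add0r => Hk.
  exists (k * M.+1)%N; split; last exact: entropy_power_mul_le.
  exact: leq_pmull.
apply: (invariant_mean_elementary fgS delta0 hypd _ im).
exact: gen_subgroup_is_subgroup.
Qed.

Section Separation.
Variables (R : realType) (G : groupType) (nu1 nu2 : G -> R) (rho : R).
Hypotheses (p1 : is_probability nu1) (p2 : is_probability nu2).
Hypotheses (rho01 : 0 < rho <= 1).
Hypothesis dom : forall n (phi : G -> \bar R), (forall x, 0 <= phi x)%E ->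
  ((rho ^+ n)%:E * Ex (convolution_power nu2 n) phi <=
     Ex (convolution_power nu1 n) phi)%E.
Local Notation pow := convolution_power.
Local Open Scope ereal_scope.

(** Accept x when s further independent steps of nu2 lead from x into A' with
    probability at least 1/2. The error under nu2 at most doubles; since nu1-steps
    dominate rho times nu2-steps, that under nu1 grows by a factor 2 / rho^s. *)
Lemma separate_earlier n s (A' : set G) (e : R) : (0 <= e)%R ->
  mass_of (pow nu1 (n + s)) (~` A') <= e%:E ->
  mass_of (pow nu2 (n + s)) A' <= e%:E ->
  exists A, mass_of (pow nu1 n) (~` A) <= (2 * e / rho ^+ s)%:E /\
    mass_of (pow nu2 n) A <= (2 * e)%:E.
Proof.
move=> e0 h1 h2; have /andP[r0 r1] := rho01.
have pp1 m := convolution_power_prob m p1; have pp2 m := convolution_power_prob m p2.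
have rs0 : (0 < rho ^+ s)%R by rewrite exprn_gt0.
pose phi x := Ex (pow nu2 s) (fun y => (\1_A' (x * y)%g)%:E).
pose psi x := Ex (pow nu2 s) (fun y => (\1_(~` A') (x * y)%g)%:E).
have i0 (B : set G) x : 0 <= (\1_B x : R)%:E by rewrite lee_fin.
have phi0 x : 0 <= phi x by apply: Ex_ge0.
have psi0 x : 0 <= psi x by apply: Ex_ge0.
have sum1 x : phi x + psi x = 1.
  rewrite /phi /psi -ExD// -[RHS](Ex_cst (pp2 s))//; apply: eq_Ex => // y _.
  by rewrite -EFinD !indicE in_setC; case: (_ \in A'); rewrite /= ?addr0 ?add0r.
have E2 : 0 <= (2%:R : R)%:E by rewrite lee_fin.
exists [set x | (2^-1)%:E <= phi x]; split.
  apply: (@le_trans _ _ (Ex (pow nu1 n) (fun x => 2%:E * psi x))).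
    rewrite mass_of_Ex; apply: le_Ex => // x _; rewrite indicE.
    case: (boolP (x \in _)) => [|_]; last by rewrite mule_ge0.
    rewrite inE /= => /negP; rewrite -ltNge => lt.
    have : (2^-1)%:E <= psi x.
      rewrite leNgt; apply/negP => lt'.
      have := lteD lt lt'; rewrite sum1 -EFinD lte_fin; lra.
    move=> le; apply: le_trans (lee_wpmul2l E2 le).
    by rewrite -EFinM lee_fin; lra.
  rewrite ExZ//.
  have : Ex (pow nu1 n) psi <= (e / rho ^+ s)%:E.
    rewrite -(@lee_pmul2l _ (rho ^+ s)%:E)//.
    rewrite -EFinM [X in _ <= X%:E]mulrC divfK ?gt_eqF//.
    apply: le_trans h1; rewrite mass_of_Ex Ex_powerD// -ExZ//; last by rewrite lee_fin ltW.
    by apply: le_Ex => // x _; apply: dom.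
  move=> /(lee_wpmul2l E2)/le_trans; apply.
  by rewrite -EFinM mulrA.
apply: (@le_trans _ _ (Ex (pow nu2 n) (fun x => 2%:E * phi x))).
  rewrite mass_of_Ex; apply: le_Ex => // x _; rewrite indicE.
  case: (boolP (x \in _)) => [|_]; last by rewrite mule_ge0.
  rewrite inE /= => le; apply: le_trans (lee_wpmul2l E2 le).
  by rewrite -EFinM lee_fin; lra.
rewrite ExZ// EFinM; apply: lee_wpmul2l => //.
by apply: le_trans h2; rewrite mass_of_Ex Ex_powerD.
Qed.

Lemma tv_dist_ge n (A : set G) (a b : R) :
  mass_of (pow nu1 n) (~` A) <= a%:E -> mass_of (pow nu2 n) A <= b%:E ->
  (1 - a - b)%:E <= tv_dist (pow nu1 n) (pow nu2 n).
Proof.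
have pp1 := convolution_power_prob n p1; have pp2 := convolution_power_prob n p2.
move=> ha hb; apply: (@le_trans _ _ `|mass_of (pow nu1 n) A - mass_of (pow nu2 n) A|).
  move: (mass_of_setC pp1 A) ha hb.
  move: (mass_of_fin pp1 A) (mass_of_fin pp2 A) (mass_of_fin pp1 (~` A)).
  case: (mass_of _ A) => [x||]//; case: (mass_of (pow nu2 n) A) => [y||]//.
  case: (mass_of _ (~` A)) => [z||]// _ _ _.
  rewrite -EFinD => -[xz]; rewrite !lee_fin => za yb.
  by apply: (@le_trans _ _ (x - y)%R); [lra|exact: ler_norm].
by apply: ereal_sup_ubound; exists A.
Qed.

Lemma tv_dist_le1 n : tv_dist (pow nu1 n) (pow nu2 n) <= 1.
Proof.
have pp1 := convolution_power_prob n p1; have pp2 := convolution_power_prob n p2.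
apply: ge_ereal_sup => _ [A _ <-].
move: (mass_of_ge0 pp1 A) (mass_of_ge0 pp2 A) (mass_of_le1 pp1 A) (mass_of_le1 pp2 A).
case: (mass_of _ A) => [x||]//; case: (mass_of (pow nu2 n) A) => [y||]//.
rewrite !lee_fin => x0 y0 x1 y1.
suff : (`|x - y| <= 1)%R by [].
by rewrite ler_norml; lra.
Qed.

(** Every n is at most k steps away from a later multiple of k, and going back
    by these steps with separate_earlier costs a bounded factor. *)
Lemma tv_dist_cvg1 (k : nat) : (0 < k)%N ->
  (forall eta : R, (0 < eta)%R -> \forall m \near \oo, exists A',
     mass_of (pow nu1 (k * m)) (~` A') <= eta%:E /\
     mass_of (pow nu2 (k * m)) A' <= eta%:E) ->
  (fun n => tv_dist (pow nu1 n) (pow nu2 n)) @ \oo --> 1.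
Proof.
move=> k0 sep; have /andP[r0 r1] := rho01.
have tv01 n : tv_dist (pow nu1 n) (pow nu2 n) \is a fin_num.
  rewrite fin_numE; apply/andP; split; apply/eqP => tvE.
    have := @tv_dist_ge n set0 1 0; rewrite tvE setC0 => /(_ (mass_of_le1 _ _)).
    by rewrite /mass_of esum_set0 => /(_ (convolution_power_prob n p1) (lexx _)).
  by have := tv_dist_le1 n; rewrite tvE.
pose g n : R := fine (tv_dist (pow nu1 n) (pow nu2 n)).
rewrite (_ : (fun n => _) = EFin \o g); last first.
  by apply/funext => n; rewrite /= fineK.
apply: cvg_EFin; first by apply: nearW.
rewrite (_ : fine \o (EFin \o g) = g)//.
apply/cvgrPdist_le => eps eps0.
have rk0 : (0 < rho ^+ k)%R by rewrite exprn_gt0.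
have eta0 : (0 < eps * rho ^+ k / 4)%R by rewrite divr_gt0// mulr_gt0.
have [M _ sepM] := sep _ eta0.
exists (k * M)%N => // n /= Mn.
pose m := (n %/ k).+1.
have nm : (n <= k * m)%N.
  by rewrite /m mulnC ltnW// {1}(divn_eq n k) mulSn addnC ltn_add2r ltn_pmod.
have smk : (k * m - n <= k)%N.
  rewrite /m leq_subLR mulnS addnC leq_add2r mulnC; exact: leq_divM.
have [|A' [h1 h2]] := sepM m.
  by rewrite /= /m leqW// leq_divRL// mulnC.
move: h1 h2; rewrite -(subnKC nm); set s := (k * m - n)%N in smk * => h1 h2.
have [A [a1 a2]] := separate_earlier (ltW eta0) h1 h2.
have rs0 : (0 < rho ^+ s)%R by rewrite exprn_gt0.
have rks : (rho ^+ k <= rho ^+ s)%R by apply: ler_wiXn2l => //; exact: ltW.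
have rk1 : (rho ^+ k <= 1)%R by rewrite exprn_ile1// ltW.
have b1 : (2 * (eps * rho ^+ k / 4) / rho ^+ s <= eps / 2)%R.
  by rewrite ler_pdivrMr//; nra.
have b2 : (2 * (eps * rho ^+ k / 4) <= eps / 2)%R by nra.
have := tv_dist_ge a1 a2; have := tv_dist_le1 n.
rewrite -(fineK (tv01 n)) -/(g n) !lee_fin ler_norml; lra.
Qed.

End Separation.

Theorem theorem1p3 (R : realType) (G : groupType) (mu : G -> R) :
  hyperbolic_group R G ->
  is_probability mu ->
  nonelementary mu ->
  finite_first_moment mu ->
  exists rho_star : R, 0 < rho_star <= 1 /\
    forall rho : R, 0 < rho < rho_star ->
      (fun n : nat =>
         tv_dist (convolution_power (noise_mass rho mu) n)
                 (prod_mass (convolution_power mu n) (convolution_power mu n)))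
        @ \oo --> 1%E.
Proof.
move=> hypG pmu nel mom.
have arith (K H L B h : R) : H <= K * (h + h / 8) -> L <= K * (h / 8) ->
    B <= 4^-1 * H -> 0 < K * h -> H + L + B < K * (h * 7 / 4).
  by clear; lra.
have arith2 (L h e : R) : L * (h + e / 2) + L * (h + e / 2) <= L * (2 * h + e).
  by clear; lra.
have arith3 (N h : R) : N * (2 * h) <= N * h + N * h by clear; lra.
have Hfin := first_moment_entropy pmu mom.
have [h [h0 low up]] := hyperbolic_positive_rate hypG pmu nel Hfin.
(* The block length k makes the entropy of a block at most 9/8 k h and ln 2 at
   most k h / 8. For k rho <= 1/4 the cross entropy of a noisy block is then at
   most 49/32 k h, which is less than k c for c = 7/4 h, a rate below 2 h. *)
have [k0 k0gt Hk0] := up (h / 8) (divr_gt0 h0 (ltr0n R 8)).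
pose j := (Num.truncn (8 * ln 2 / h)).+1.
have jln : 8 * ln 2 <= j%:R * h.
  by rewrite -ler_pdivrMr// ltW// truncnS_gt.
pose k := (k0 * j)%N.
have kgt : (0 < k)%N by rewrite muln_gt0 k0gt.
have kR : 0 < k%:R :> R by rewrite ltr0n.
have Hk := entropy_power_mul_le pmu j Hk0; rewrite -/k in Hk.
have kln : ln 2 <= k%:R * (h / 8).
  have : j%:R <= k%:R :> R by rewrite ler_nat leq_pmull.
  by move=> jk; have : j%:R * h <= k%:R * h by [exact: ler_wpM2r (ltW h0) _ _ jk]; lra.
have EH : entropy (convolution_power mu k) = (fine (entropy (convolution_power mu k)))%:E.
  by rewrite fineK// entropy_power_fin.
set H := fine _ in EH.
have HH : H <= k%:R * (h + h / 8) by rewrite -lee_fin -EH.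
have H0 : 0 <= H by rewrite -lee_fin -EH entropy_ge0//; exact: convolution_power_prob.
have k4 : 1 <= 4 * k%:R :> R by rewrite -natrM ler1n muln_gt0.
exists (4 * k%:R)^-1; split.
  by rewrite invr_gt0 mulr_gt0//= invf_le1// mulr_gt0.
move=> rho /andP[rho0 rholt].
have rhok : k%:R * rho <= 4^-1.
  have := ltW rholt; rewrite invfM -ler_pdivrMr ?invr_gt0// invrK; lra.
have rho1 : rho < 1.
  by apply: lt_le_trans rholt _; rewrite invf_le1// mulr_gt0.
have rho01 : 0 < rho < 1 by rewrite rho0.
have rho01' : 0 < rho <= 1 by rewrite rho0 ltW.
(* Bernoulli's inequality. *)
have bern : 1 - (1 - rho) ^+ k <= 4^-1.
  apply: le_trans rhok; elim: (k) => [|n IHn]; first by rewrite expr0 mul0r subrr.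
  have pn : (1 - rho) ^+ n <= 1.
    by rewrite exprn_ile1 ?subr_ge0 ?(ltW rho1)// gerBl ltW.
  have : rho * (1 - rho) ^+ n <= rho by rewrite ger_pMr.
  by rewrite exprS -(natr1 n); lra.
set nu1 := noise_mass rho mu; pose nu2 := prod_mass mu mu.
have p1 : is_probability nu1 by apply: noise_mass_prob => //; rewrite !ltW.
have p2 : is_probability nu2 by exact: prod_mass_prob.
rewrite (_ : (fun n => _) = fun n => tv_dist (convolution_power nu1 n) (convolution_power nu2 n));
  last by apply/funext => n; rewrite convolution_power_prod.
have dom n (phi : G * G -> \bar R) : (forall x, 0 <= phi x)%E ->
    ((rho ^+ n)%:E * Ex (convolution_power nu2 n) phi <=
     Ex (convolution_power nu1 n) phi)%E by exact: noise_ge_indep.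
apply: (tv_dist_cvg1 p1 p2 rho01' dom kgt) => eta eta0.
have [supp cross] := noise_cross_entropy pmu rho01 EH.
set q := noise_mass 2^-1 _ in supp cross.
have pk := convolution_power_prob k pmu.
have pq : is_probability q.
  by apply: noise_mass_prob => //; rewrite invr_ge0 ler0n/= invf_le1// ler1n.
pose c := h * 7 / 4.
have gap : H + ln 2 + (1 - (1 - rho) ^+ k) * H < k%:R * c.
  by apply: arith => //; [exact: ler_wpM2r|rewrite mulr_gt0].
have up1 := typical_set_upper (convolution_power_prob k p1) pq supp cross gap eta0.
have low2 n : ((n%:R * (2 * h))%:E <= entropy (convolution_power nu2 n))%E.
  rewrite convolution_power_prod// entropy_prod//; try exact: convolution_power_prob.
  by apply: le_trans (leeD (low n) (low n)); rewrite -EFinD lee_fin.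
have up2 eps : 0 < eps -> exists2 k, (0 < k)%N &
    (entropy (convolution_power nu2 k) <= (k%:R * (2 * h + eps))%:E)%E.
  move=> eps0; have [l l0 Hl] := up (eps / 2) (divr_gt0 eps0 (ltr0n R 2)).
  exists l => //.
  rewrite convolution_power_prod// entropy_prod//; try exact: convolution_power_prob.
  by apply: le_trans (leeD Hl Hl) _; rewrite -EFinD lee_fin.
have c2 : 0 <= c < 2 * h.
  by rewrite /c; clear -h0; apply/andP; split; lra.
have [N _ small] := small_sets_negligible p2 c2 low2 up2 eta0.
near=> m.
exists [set z | expR (- (m%:R * (k%:R * c))) <= convolution_power q m z]; split.
  have typical : (mass_of (convolution_power (convolution_power nu1 k) m)
      [set z | (convolution_power q m z < expR (- (m%:R * (k%:R * c))))%R] <= eta%:E)%E.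
    by near: m.
  rewrite convolution_power_mul//; apply: le_trans typical.
  apply: mass_of_le; first by do 2!apply: convolution_power_prob.
  by move=> z /= /negP; rewrite -ltNge.
apply: small => /=.
  have : (N <= m)%N by near: m; exists N.
  by move=> /leq_trans; apply; rewrite leq_pmull.
apply: le_trans (set_size_level _ (expR_gt0 _)) _; first exact: convolution_power_prob.
by rewrite -expRN opprK lee_fin ler_expR natrM mulrA (mulrC m%:R).
Unshelve. all: by end_near. Qed.
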